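(* Let $c>1$ be real, $n\in\mathbb{N}$, and $\varepsilon:=c-\lfloor c\rfloor\in[0,1)$. In the $c$-MultiQueue with $n$ queues, the rank error $E^{(s)}$ of the $s$-th deletion converges in distribution as $s\to\infty$ to a random variable $E$ (the long-run rank error), and: (i) For $c=2$: $\mathbb{E}[E]=\tfrac56 n-1+\tfrac{1}{6n}$. (ii) For $c=1+\varepsilon$ with $\varepsilon\in(0,1)$: $\mathbb{E}[E]=\left(\tfrac1\varepsilon-\tfrac\varepsilon6\right)n-\tfrac1\varepsilon+\tfrac{\varepsilon}{6n}$. (iii) For every $c>1$: \[ n\int_0^1 f_c(x)\,dx-\tfrac{c}{c-1}\le \mathbb{E}[E]\le n\int_0^1 f_c(x)\,dx,\] where $f_c:(0,1)\to\mathbb{R}$, $f_c(x)=x^{\lfloor c\rfloor-1}(1-\varepsilon+\varepsilon x)\cdot\dfrac{1-x^{\lfloor c\rfloor}(1-\varepsilon+\varepsilon x)}{1-x^{\lfloor c\rfloor-1}(1-\varepsilon+\varepsilon x)}$. (iv) For every $c\ge 2$: $\tfrac{n}{\lceil c\rceil}-\tfrac{c}{c-1}\le\mathbb{E}[E]\le\tfrac{n}{\lfloor c\rfloor-1}$.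
   Context: The $c$-MultiQueue with $n$ queues: take an infinite totally ordered set of elements $x_1<x_2<\cdots$ and assign each element independently and uniformly at random to one of $n$ priority queues. Each deletion (with fresh independent randomness) selects $\lfloor c\rfloor+1$ queues with probability $\varepsilon=c-\lfloor c\rfloor$ and $\lfloor c\rfloor$ queues otherwise, each selected independently and uniformly at random among the $n$ queues, and deletes the minimum element of the selected queue whose minimum is smallest. Equivalently, ordering the queues by their minima, the deleted queue is the $i$-th one with $\Pr[\text{index}\le i]=1-(1-\tfrac in)^{\lfloor c\rfloor}(1-\varepsilon\tfrac in)$. The rank error of a deletion is $r-1$, where $r$ is the rank of the deleted element among all elements present just before the deletion (smallest has rank $1$). *)

(* Defs.v *)
From HB Require Import structures.
From mathcomp Require Import all_boot all_order all_algebra.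
From mathcomp Require Import all_classical all_reals all_analysis.
Set Implicit Arguments. Unset Strict Implicit. Unset Printing Implicit Defensive.
Import Order.TTheory GRing.Theory Num.Theory.
Import numFieldNormedType.Exports.
Local Open Scope ring_scope.

(* The c-MultiQueue with n queues, truncated to the first N elements.        *)
(* Element x_(j+1) is represented by j : 'I_N; a : {ffun 'I_N -> 'I_n} is     *)
(* the (uniform, independent) assignment of elements to queues.             *)
(* k = floor c.  A deletion's randomness is a pair (b, f): b = true means    *)
(* floor c + 1 queues are selected (probability eps), otherwise floor c;    *)
(* f lists k+1 independent uniform queue picks, of which the first k (resp.  *)
(* all k+1 when b) are the selected queues.                                  *)

Section MQ.
Variables (n k N : nat).

Definition choiceT := (bool * {ffun 'I_k.+1 -> 'I_n})%type.

(* one deletion step from the set D of already deleted elements; returns the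
   rank error of the deletion and the new deleted set.  It fails (None) when
   some queue has no remaining element among the first N elements, i.e. when
   the truncation could differ from the infinite process. *)
Definition mq_step (a : {ffun 'I_N -> 'I_n}) (D : {set 'I_N}) (ch : choiceT)
  : option (nat * {set 'I_N}) :=
  if [forall q : 'I_n, [exists j : 'I_N, (a j == q) && (j \notin D)]] then
    let sel q := [exists i : 'I_k.+1, ((i < k)%N || ch.1) && (ch.2 i == q)] in
    match [pick j : 'I_N | [&& j \notin D, sel (a j) &
             [forall i : 'I_N, ((i \notin D) && sel (a i)) ==> (j <= i)%N]]] with
    | Some j => Some (#|[set i : 'I_N | (i \notin D) && (i < j)%N]|, j |: D)
    | None => None
    end
  else None.

Fixpoint mq_run (a : {ffun 'I_N -> 'I_n}) (D : {set 'I_N}) (chs : seq choiceT)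
  : option nat :=
  match chs with
  | [::] => None
  | [:: ch] => omap fst (mq_step a D ch)
  | ch :: chs' =>
      match mq_step a D ch with
      | Some (_, D') => mq_run a D' chs'
      | None => None
      end
  end.

End MQ.

Section Law.
Variable R : realType.

Definition mq_k (c : R) : nat := Num.truncn c.
Definition mq_eps (c : R) : R := c - (Num.floor c)%:~R.

Definition choice_weight (c : R) (n : nat) (ch : choiceT n (mq_k c)) : R :=
  (if ch.1 then mq_eps c else 1 - mq_eps c) / (n%:R ^+ (mq_k c).+1).

(* Pr[ truncation to N elements is faithful for the first s deletions and the
   rank error of the s-th deletion equals e ]                               *)
Definition mq_probN (c : R) (n s e N : nat) : R :=
  \sum_(a : {ffun 'I_N -> 'I_n})
   \sum_(chs : {ffun 'I_s -> choiceT n (mq_k c)})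
     (n%:R ^+ N)^-1 * (\prod_(t < s) @choice_weight c n (chs t)) *
     (mq_run a finset.set0 [seq chs t | t : 'I_s] == Some e)%:R.

(* Pr[ E^(s) = e ] in the infinite process: the (monotone) limit N -> oo *)
Definition rank_error_law (c : R) (n s e : nat) : R :=
  limn (fun N => mq_probN c n s e N).

Definition f_c (c : R) (x : R) : R :=
  let k := mq_k c in let eps := mq_eps c in
  x ^+ k.-1 * (1 - eps + eps * x) *
  ((1 - x ^+ k * (1 - eps + eps * x)) / (1 - x ^+ k.-1 * (1 - eps + eps * x))).

End Law.

(* Main.v *)
(* The labels of the remaining elements form a word over the queues, and deleting
   the minimum of the selected queues removes the first letter of the word that is
   selected. The law of this word has a density with respect to the uniform measure,
   depending only on the shortest prefix in which every queue occurs. A deletion acts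
   on densities by a positive operator, a finite sum over the insertions of one
   letter, and it fixes the density proportional to the product, over the repeated
   letters of that prefix, of 1 / sigma_i, where i is the number of distinct letters
   already met and sigma_i = Pr[index <= i]. Under this density the gaps between
   consecutive queue minima are independent and geometric with parameter
   i / (n sigma_i), which yields E[E] = sum_(0 < i < n) f_c (i / n).

   The initial density is at most a multiple of the stationary one, hence so are all
   later ones. Since the first element is deleted with probability sigma_1 > 0, after
   m steps every density is bounded below by sigma_1^m times its mass on the words
   that are complete after m letters. The L1 distance to the stationary density
   therefore tends to 0.

   Finally f_c is nondecreasing with limit c / (c - 1) at 1, which bounds the
   difference between n times its integral and its Riemann sum. *)

Require Import Defs.
From HB Require Import structures.
From mathcomp Require Import all_boot all_order all_algebra.
From mathcomp Require Import all_classical all_reals all_analysis.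
From mathcomp Require Import measurable_realfun.
From mathcomp Require Import zify ring lra.
Set Implicit Arguments. Unset Strict Implicit. Unset Printing Implicit Defensive.
Import Order.TTheory GRing.Theory Num.Theory.
Import numFieldNormedType.Exports.
Local Open Scope ring_scope.
Local Open Scope classical_set_scope.

(** * Words *)

Section Mean.
Variables (R : realType) (n : nat).
Hypothesis n_gt0 : (0 < n)%N.
Implicit Types (w : seq 'I_n) (F G : seq 'I_n -> R).

(** Expectation of [F] at a uniform random word of length [L]. The recursion on the first letter
    agrees with that of [wt]. *)
Fixpoint mean (L : nat) F : R :=
  if L is L'.+1 then n%:R^-1 * \sum_(q : 'I_n) mean L' (fun w => F (q :: w))
  else F [::].

Lemma ler_mean L F G :
  (forall w, size w = L -> F w <= G w) -> mean L F <= mean L G.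
Proof.
elim: L F G => [|L IH] F G FG /=; first exact: FG.
rewrite ler_wpM2l ?invr_ge0 ?ler0n //; apply: ler_sum => q _.
by apply: IH => w sw; apply: FG; rewrite /= sw.
Qed.

Lemma eq_mean L F G :
  (forall w, size w = L -> F w = G w) -> mean L F = mean L G.
Proof. by move=> FG; apply/eqP; rewrite eq_le !ler_mean // => w /FG ->. Qed.

Lemma meanD L F G : mean L (fun w => F w + G w) = mean L F + mean L G.
Proof.
elim: L F G => [|L IH] F G //=.
by rewrite -mulrDr -big_split /=; congr (_ * _); apply: eq_bigr => q _; rewrite IH.
Qed.

Lemma meanZ L (a : R) F : mean L (fun w => a * F w) = a * mean L F.
Proof.
elim: L F => [|L IH] F //=.
rewrite [RHS]mulrCA [a * _]mulr_sumr; congr (_ * _).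
by apply: eq_bigr => q _; rewrite IH.
Qed.

Lemma meanB L F G : mean L (fun w => F w - G w) = mean L F - mean L G.
Proof.
rewrite -[- mean L G]mulN1r -meanZ -meanD.
by apply: eq_mean => w _; rewrite mulN1r.
Qed.

Lemma mean_cst L (a : R) : mean L (fun=> a) = a.
Proof.
elim: L => [|L IH] //=; under eq_bigr do rewrite IH.
by rewrite sumr_const card_ord -[a *+ n]mulr_natl mulKf // pnatr_eq0 -lt0n.
Qed.

Lemma mean_sum (I : Type) (r : seq I) (P : pred I) L (F : I -> seq 'I_n -> R) :
  mean L (fun w => \sum_(i <- r | P i) F i w) = \sum_(i <- r | P i) mean L (F i).
Proof.
elim: r => [|i r IH].
  rewrite big_nil -[RHS](mean_cst L); apply: eq_mean => w _; exact: big_nil.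
rewrite big_cons -IH; case: ifP => Pi; rewrite -?meanD;
  by apply: eq_mean => w _; rewrite big_cons Pi.
Qed.

Lemma mean_ge0 L F : (forall w, size w = L -> 0 <= F w) -> 0 <= mean L F.
Proof. by move=> F0; rewrite -(mean_cst L 0); apply: ler_mean. Qed.

Lemma ler_norm_mean L F : `|mean L F| <= mean L (fun w => `|F w|).
Proof.
rewrite ler_norml; apply/andP; split; last by apply: ler_mean => w _; exact: ler_norm.
rewrite -mulN1r -meanZ; apply: ler_mean => w _.
by rewrite mulN1r; apply: lerNnormlW.
Qed.

Lemma mean_cat L m F :
  mean (L + m) F = mean L (fun u => mean m (fun v => F (u ++ v))).
Proof.
elim: L F => [|L IH] F //=; congr (_ * _); apply: eq_bigr => q _; exact: IH.
Qed.

Definition ins j (q : 'I_n) w := take j w ++ q :: drop j w.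
Definition del j w := take j w ++ drop j.+1 w.

Lemma take_ins j q w : (j <= size w)%N -> take j (ins j q w) = take j w.
Proof. by move=> jw; rewrite /ins take_size_cat ?size_takel. Qed.

Lemma takeS_ins j q w :
  (j <= size w)%N -> take j.+1 (ins j q w) = rcons (take j w) q.
Proof.
by move=> jw; rewrite /ins -cat_rcons take_size_cat // size_rcons size_takel.
Qed.

Lemma del_ins j q w : (j <= size w)%N -> del j (ins j q w) = w.
Proof.
move=> jw; rewrite /del take_ins //.
by rewrite /ins -cat_rcons drop_size_cat ?cat_take_drop // size_rcons size_takel.
Qed.

(** The letters are independent and uniform, so the one at position [j] can be drawn last. This
    turns deletions at [j] into averages over insertions at [j]. *)
Lemma mean_ins L j F : (j <= L)%N ->
  mean L.+1 F = n%:R^-1 * \sum_(q : 'I_n) mean L (fun w => F (ins j q w)).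
Proof.
elim: L j F => [|L IH] [|j] F // jL.
rewrite -[LHS]/(n%:R^-1 * \sum_q mean L.+1 (fun w => F (q :: w))).
congr (_ * _); under eq_bigr do rewrite (IH j) //.
by rewrite -mulr_sumr exchange_big /= mulr_sumr; apply: eq_bigr => q _.
Qed.

Definition full w := [forall q, q \in w].

Lemma fullP w : reflect (forall q, q \in w) (full w).
Proof. exact: forallP. Qed.

Lemma full_cat u v : full u -> full (u ++ v).
Proof. by move=> /fullP h; apply/fullP => q; rewrite mem_cat h. Qed.

Lemma full_ins j q w : full w -> full (ins j q w).
Proof.
move=> /fullP h; apply/fullP => x; have := h x.
by rewrite -{1}(cat_take_drop j w) /ins !mem_cat inE => /orP[->|->] //; rewrite !orbT.
Qed.

(* [F] depends only on the shortest prefix containing every letter, so that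
   [mean L F] approximates the expectation of [F] over infinite words. *)
Definition stable F :=
  (forall w, ~~ full w -> F w = 0) /\ (forall w v, full w -> F (w ++ v) = F w).

Lemma stableD F G : stable F -> stable G -> stable (fun w => F w + G w).
Proof.
move=> [F1 F2] [G1 G2]; split=> [w nf|w v f]; first by rewrite F1 // G1 // addr0.
by rewrite F2 // G2.
Qed.

Lemma stable_comp (h : R -> R) F : h 0 = 0 -> stable F -> stable (fun w => h (F w)).
Proof. by move=> h0 [F1 F2]; split=> [w nf|w v f]; [rewrite F1|rewrite F2]. Qed.

Lemma stableZ (a : R) F : stable F -> stable (fun w => a * F w).
Proof. by apply: (stable_comp (h := fun x => a * x)); rewrite mulr0. Qed.

Lemma stableB F G : stable F -> stable G -> stable (fun w => F w - G w).
Proof.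
move=> [F1 F2] [G1 G2]; split=> [w nf|w v f]; first by rewrite F1 // G1 // subr0.
by rewrite F2 // G2.
Qed.

Lemma stableM F (r : seq 'I_n -> R) : stable F ->
  (forall w v, full w -> r (w ++ v) = r w) -> stable (fun w => F w * r w).
Proof.
move=> [F1 F2] rc; split=> [w nf|w v f]; first by rewrite F1 // mul0r.
by rewrite F2 // rc.
Qed.

(** A full word keeps its value when lengthened, and a word that is not full yet can only gain. *)
Lemma mean_nondecreasing F L m : stable F -> (forall w, 0 <= F w) ->
  (L <= m)%N -> mean L F <= mean m F.
Proof.
move=> [F1 F2] F0 /subnKC <-; rewrite mean_cat; apply: ler_mean => u _.
have [fu|nfu] := boolP (full u); last by rewrite F1 //; apply: mean_ge0.
by under eq_mean do rewrite F2 //; rewrite mean_cst.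
Qed.

End Mean.

Section Level.
Variable n : nat.
Implicit Types (A : {set 'I_n}) (w : seq 'I_n).

(** Distinct letters met once [w] is read, those of [A] counting as met before; the set [A] makes
    induction from the front possible. *)
Definition lev A w := #|A :|: [set x in w]|.

Lemma lev_nil A : lev A [::] = #|A|.
Proof. by rewrite /lev; congr #|pred_of_set _|; apply/setP => x; rewrite !inE orbF. Qed.

Lemma lev_cons A q w : lev A (q :: w) = lev (q |: A) w.
Proof.
by rewrite /lev; congr #|pred_of_set _|; apply/setP => x; rewrite !inE orbCA orbA.
Qed.

Lemma card_ord_set_le A : (#|A| <= n)%N.
Proof. by rewrite -[X in (_ <= X)%N]card_ord max_card. Qed.

Lemma lev_le A w : (lev A w <= n)%N.
Proof. exact: card_ord_set_le. Qed.

Lemma lev_take_le A i j w : (i <= j)%N -> (lev A (take i w) <= lev A (take j w))%N.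
Proof.
move=> ij; apply: subset_leq_card; apply: finset.setUS; apply/fintype.subsetP => x.
by rewrite !inE -(take_takel _ ij) => /mem_take.
Qed.

Lemma lev_rcons_le A q w : (lev A w <= lev A (rcons w q))%N.
Proof.
apply: subset_leq_card; apply: finset.setUS; apply/fintype.subsetP => x.
by rewrite !inE mem_rcons inE => ->; rewrite orbT.
Qed.

Lemma lev_rcons_mem A q w : q \in w -> lev A (rcons w q) = lev A w.
Proof.
move=> qw; rewrite /lev; congr #|pred_of_set (A :|: _)|; apply/setP => x.
by rewrite !inE mem_rcons inE; case: eqP => [->|].
Qed.

Lemma lev_full A w : full w -> lev A w = n.
Proof.
move=> /fullP fw; rewrite /lev (_ : _ :|: _ = [set: 'I_n]%SET) ?cardsT ?card_ord //.
by apply/setP => x; rewrite !inE fw orbT.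
Qed.

Lemma cardU1_notin A q : q \notin A -> #|q |: A| = #|A|.+1.
Proof. by move=> qA; rewrite cardsU1 qA. Qed.

End Level.

(** * Weights of words by their repeated letters *)

Section Weight.
Variables (R : realType) (n : nat) (v : nat -> R).
Implicit Types (A : {set 'I_n}) (w : seq 'I_n).

(* A repeated letter read after [i] distinct ones has weight [v i]; words that do
   not complete [A] have weight 0. *)
Fixpoint wt A w : R :=
  if w is q :: w' then (if q \in A then v #|A| else 1) * wt (q |: A) w'
  else (A == [set: 'I_n]%SET)%:R.

Lemma wt_gt0 A w : (forall i, (0 < i <= n)%N -> 0 < v i) ->
  (forall q, (q \in A) || (q \in w)) -> 0 < wt A w.
Proof.
move=> v0; elim: w A => [|q w IH] A h /=.
  suff -> : A = [set: 'I_n]%SET by rewrite eqxx ltr01.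
  by apply/setP => q; rewrite inE; have := h q; rewrite in_nil orbF.
apply: mulr_gt0; last first.
  apply: IH => x; have := h x; rewrite !inE => /or3P[] -> //; by rewrite ?orbT.
case: ifP => // qA; apply: v0.
by rewrite card_ord_set_le andbT card_gt0; apply/set0Pn; exists q.
Qed.

Lemma wt_ge1 A w : (forall i, (0 < i <= n)%N -> 1 <= v i) ->
  (forall q, (q \in A) || (q \in w)) -> 1 <= wt A w.
Proof.
move=> v1; elim: w A => [|q w IH] A h /=.
  suff -> : A = [set: 'I_n]%SET by rewrite eqxx.
  by apply/setP => q; rewrite inE; have := h q; rewrite in_nil orbF.
apply: mulr_ege1; last first.
  apply: IH => x; have := h x; rewrite !inE => /or3P[] -> //; by rewrite ?orbT.
case: ifP => // qA; apply: v1.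
by rewrite card_ord_set_le andbT card_gt0; apply/set0Pn; exists q.
Qed.

Lemma wt_eq0 A w q : q \notin A -> q \notin w -> wt A w = 0.
Proof.
elim: w A => [|x w IH] A qA /=.
  by move=> _; case: eqP qA => // ->; rewrite inE.
rewrite inE negb_or => /andP[qx qw]; rewrite (IH (x |: A)) ?mulr0 //.
by rewrite !inE negb_or qx.
Qed.

Lemma wt_setT w : v n = 1 -> wt [set: 'I_n]%SET w = 1.
Proof.
move=> vn; elim: w => [|x w IH] /=; first by rewrite eqxx.
by rewrite inE cardsT card_ord vn mul1r finset.setUT IH.
Qed.

(** Once all letters have occurred, every further letter is a repetition at level [n], of weight
    [v n = 1]. *)
Lemma wt_cat A w u : v n = 1 ->
  (forall q, (q \in A) || (q \in w)) -> wt A (w ++ u) = wt A w.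
Proof.
move=> vn; elim: w A => [|q w IH] A h /=.
  suff -> : A = [set: 'I_n]%SET by rewrite wt_setT // eqxx.
  by apply/setP => q; rewrite inE; have := h q; rewrite in_nil orbF.
rewrite IH // => x; have := h x; rewrite !inE => /or3P[] -> //; by rewrite ?orbT.
Qed.

Lemma wt_stable : v n = 1 -> stable (wt finset.set0).
Proof.
move=> vn; split=> [w|w u /fullP fw]; last by apply: wt_cat => // q; rewrite fw orbT.
by move=> /forallPn[q qw]; apply: (wt_eq0 _ qw); rewrite inE.
Qed.

End Weight.

(** Unit weights give the initial density of the chain, so the recursion for [wt] also computes its
    mass. *)
Lemma wt1 (R : realType) n (w : seq 'I_n) :
  wt (fun=> 1 : R) finset.set0 w = (full w)%:R.
Proof.
have [/fullP fw|/forallPn[q qw]] := boolP (full w); last first.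
  by apply: (wt_eq0 _ _ qw); rewrite inE.
have : forall q, (q \in finset.set0) || (q \in w) by move=> q; rewrite fw orbT.
elim: w finset.set0 {fw} => [|q w IH] A h /=.
  suff -> : A = [set: 'I_n]%SET by rewrite eqxx.
  by apply/setP => q; rewrite inE; have := h q; rewrite in_nil orbF.
rewrite if_same mul1r; apply: IH => x.
by have := h x; rewrite !inE => /or3P[] -> //; rewrite ?orbT.
Qed.

Lemma cvg_affine_rec (R : realType) (rho l : R) (x b : nat -> R) :
  0 <= rho < 1 -> b @ \oo --> l ->
  (forall L, x L.+1 = rho * x L + b L) -> x @ \oo --> l / (1 - rho).
Proof.
move=> /andP[r0 r1] bl rec.
have r1' : 0 < 1 - rho by rewrite subr_gt0.
set a := l / (1 - rho).
have al : l = (1 - rho) * a by rewrite /a mulrC divfK // gt_eqF.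
apply/cvgrPdist_le => e e0.
have e2 : 0 < e * (1 - rho) / 2 by rewrite divr_gt0 // mulr_gt0.
have [N _ HN] : \forall L \near \oo, `|l - b L| <= e * (1 - rho) / 2.
  by move/cvgrPdist_le : bl; exact.
(* The error [e * (1 - rho) / 2] made at each step adds up, along the geometric series, to at most
   [e / 2]. *)
have bnd j : `|a - x (N + j)%N| <= rho ^+ j * `|a - x N| + e / 2.
  elim: j => [|j IH]; first by rewrite addn0 expr0 mul1r lerDl divr_ge0 // ltW.
  rewrite addnS rec.
  have -> : a - (rho * x (N + j)%N + b (N + j)%N) =
    rho * (a - x (N + j)%N) + (l - b (N + j)%N) by rewrite al; ring.
  apply: le_trans (ler_normD _ _) _; rewrite normrM (ger0_norm r0).
  have h1 := HN (N + j)%N (leq_addr _ _).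
  have h2 := ler_wpM2l r0 IH.
  rewrite exprS; nra.
have [N' _ HN'] : \forall j \near \oo, `|0 - geometric `|a - x N| rho j| <= e / 2.
  have rn : `|rho| < 1 by rewrite ger0_norm.
  by have /cvgrPdist_le := cvg_geometric `|a - x N| rn; apply; rewrite divr_gt0.
exists (N + N')%N => // m /= Nm.
have -> : m = (N + (m - N))%N by rewrite subnKC // (leq_trans (leq_addr _ _) Nm).
apply: le_trans (bnd _) _.
have := HN' (m - N)%N; rewrite /= leq_subRL ?(leq_trans (leq_addr _ _) Nm) // => /(_ Nm).
rewrite /geometric sub0r normrN => h.
by have := le_trans (ler_norm _) h; rewrite mulrC; lra.
Qed.

(** * Limits of mass and mean rank, level by level *)

Section LevelRecursion.
Variables (R : realType) (n : nat) (tau v : nat -> R).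
Hypothesis n_gt0 : (0 < n)%N.
Implicit Types (A : {set 'I_n}) (w : seq 'I_n).

Notation fr i := (i%:R / n%:R : R).

(** By [mean_wt], the mean of [wt v A] over words of length [L] when [A] has [i] letters: the next
    letter is a repetition with probability i / n. *)
Fixpoint level_mass i L : R :=
  if L is L'.+1 then
    fr i * v i * level_mass i L' + (1 - fr i) * level_mass i.+1 L'
  else (i == n)%:R.

Fixpoint level_rank i L : R :=
  if L is L'.+1 then fr i * v i * (level_rank i L' + tau i * level_mass i L')
    + (1 - fr i) * (level_rank i.+1 L' + tau i.+1 * level_mass i.+1 L') else 0.

Lemma avg_mem A (x y : R) :
  n%:R^-1 * \sum_q (if q \in A then x else y) = fr #|A| * x + (1 - fr #|A|) * y.
Proof.
rewrite (bigID (mem A)) /= (eq_bigr (fun=> x)); last by move=> q ->.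
rewrite [X in _ + X](eq_bigr (fun=> y)); last by move=> q /negbTE ->.
rewrite !sumr_const (_ : #|[pred q | q \notin A]| = (n - #|A|)%N); last first.
  have -> : #|[pred q | q \notin A]| = #|[predC A]| by apply: eq_card => q; rewrite !inE.
  by have := cardC A; rewrite card_ord; lia.
have n0 : n%:R != 0 :> R by rewrite pnatr_eq0 -lt0n.
rewrite -[x *+ _]mulr_natl -[y *+ _]mulr_natl natrB ?card_ord_set_le //.
by field.
Qed.

Lemma mean_wt L A : mean L (wt v A) = level_mass #|A| L.
Proof.
elim: L A => [|L IH] A /=.
  congr (nat_of_bool _)%:R; apply/eqP/eqP => [->|hA]; first by rewrite cardsT card_ord.
  by apply/eqP; rewrite eqEcard finset.subsetT cardsT card_ord hA leqnn.
under eq_bigr do rewrite meanZ IH.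
rewrite -mulrA -avg_mem; congr (_ * _); apply: eq_bigr => q _.
case: ifPn => qA; last by rewrite mul1r cardU1_notin.
by rewrite (finset.setUidPr _) // finset.sub1set.
Qed.

(** Expected position, counted from 0, of the letter of [w] that is deleted. The queues in [A] are
    met before [w], and a deletion there contributes nothing. *)
Definition rankA A w : R :=
  \sum_(e < size w) e%:R * (tau (lev A (take e w)) - tau (lev A (take e.+1 w))).

Hypothesis taun : tau n = 0.

(** A letter put in front moves all positions of [w] by one, which adds the probability
    [tau #|q |: A|] that the deletion happens inside [w]. *)
Lemma wt_rankA_cons A q w : wt v A (q :: w) * rankA A (q :: w) =
  (if q \in A then v #|A| else 1) *
  (wt v (q |: A) w * rankA (q |: A) w + tau #|q |: A| * wt v (q |: A) w).
Proof.
rewrite /= -mulrA; congr (_ * _).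
have [/forallP cov|/forallPn[y]] :=
    boolP [forall x, (x \in q |: A) || (x \in w)]; last first.
  by rewrite negb_or => /andP[h1 h2]; rewrite (wt_eq0 _ h1 h2) !mul0r mulr0 addr0.
rewrite [tau _ * _]mulrC -mulrDr; congr (_ * _).
rewrite /rankA big_ord_recl mul0r add0r.
under eq_bigr do rewrite lift0 /= !lev_cons -natr1 mulrDl mul1r.
rewrite big_split /=; congr (_ + _).
set g := fun e => - tau (lev (q |: A) (take e w)).
rewrite -(big_mkord xpredT (fun e => tau (lev (q |: A) (take e w)) -
  tau (lev (q |: A) (take e.+1 w)))) (telescope_sumr_eq g) //; last first.
  by move=> e _; rewrite /g opprK addrC.
rewrite /g take_size take0 lev_nil (_ : lev _ w = n) ?taun ?oppr0 ?add0r ?opprK //.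
rewrite /lev (_ : _ :|: _ = [set: 'I_n]%SET) ?cardsT ?card_ord //.
by apply/setP => x; have := cov x; rewrite !inE => ->.
Qed.

Lemma mean_wt_rankA L A : mean L (fun w => wt v A w * rankA A w) = level_rank #|A| L.
Proof.
elim: L A => [|L IH] A; first by rewrite /= /rankA big_ord0 mulr0.
rewrite /=; under eq_bigr do under eq_mean do rewrite -/(wt v A (_ :: _)) wt_rankA_cons.
under eq_bigr do rewrite meanZ meanD meanZ IH mean_wt.
rewrite -mulrA -avg_mem; congr (_ * _); apply: eq_bigr => q _.
case: ifPn => qA; last by rewrite mul1r cardU1_notin.
by rewrite (finset.setUidPr _) // finset.sub1set.
Qed.

Hypothesis vn : v n = 1.
Hypothesis rho_lt1 : forall i, (i < n)%N -> 0 <= fr i * v i < 1.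

(** Limit mass from level [i], and mean rank under the normalised weight. At level [l] the number of
    repetitions is geometric with mean r / (1 - r), where r = (l / n) * v l; each adds [tau l], and
    the new letter that ends the level adds [tau l.+1]. *)
Let z i := \prod_(i <= l < n) ((1 - fr l) / (1 - fr l * v l)).
Let m i := \sum_(i <= l < n) (tau l.+1 + fr l * v l / (1 - fr l * v l) * tau l).

Let frn : fr n = 1.
Proof. by rewrite divff // pnatr_eq0 -lt0n. Qed.

Lemma level_massn L : level_mass n L = 1.
Proof. by elim: L => [|L IH] /=; rewrite ?eqxx // IH frn vn !mulr1 subrr mul0r addr0. Qed.

Lemma level_rankn L : level_rank n L = 0.
Proof.
by elim: L => [|L IH] //=; rewrite IH frn vn taun mul0r addr0 mulr0 subrr mul0r addr0.
Qed.

Lemma level_mass_cvg i : (i <= n)%N -> level_mass i @ \oo --> z i.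
Proof.
move=> /subnKC; move: (n - i)%N => d; elim: d i => [|d IH] i.
  rewrite addn0 => ->; rewrite /z big_geq // (_ : level_mass n = cst 1); first exact: cvg_cst.
  by apply/funext => L; rewrite level_massn.
move=> idn; have ltin : (i < n)%N by rewrite -idn addnS ltnS leq_addr.
rewrite /z big_ltn // -/(z i.+1) mulrAC.
apply: (@cvg_affine_rec _ _ _ _ (fun L => (1 - fr i) * level_mass i.+1 L)) => //.
- exact: rho_lt1.
- by apply: cvgMl_tmp; apply: IH; rewrite addSnnS.
Qed.

Lemma level_rank_cvg i : (i <= n)%N -> level_rank i @ \oo --> z i * m i.
Proof.
move=> /subnKC; move: (n - i)%N => d; elim: d i => [|d IH] i.
  rewrite addn0 => ->; rewrite /m big_geq // mulr0 (_ : level_rank n = cst 0); first exact: cvg_cst.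
  by apply/funext => L; rewrite level_rankn.
move=> idn; have ltin : (i < n)%N by rewrite -idn addnS ltnS leq_addr.
have r1 : 1 - fr i * v i != 0.
  by rewrite subr_eq0 eq_sym lt_eqF //; case/andP: (rho_lt1 ltin).
have -> : z i * m i = (fr i * v i * (tau i * z i) +
   (1 - fr i) * (z i.+1 * m i.+1 + tau i.+1 * z i.+1)) / (1 - fr i * v i).
  rewrite /z /m !(big_ltn ltin) -/(z i.+1) -/(m i.+1).
  by move: (fr i) r1 (z _) (m _) => f r1 zz mm; field.
apply: (@cvg_affine_rec _ _ _ _ (fun L => fr i * v i * (tau i * level_mass i L) +
  (1 - fr i) * (level_rank i.+1 L + tau i.+1 * level_mass i.+1 L))).
- exact: rho_lt1.
- have idn' : (i.+1 + d)%N = n by rewrite addSnnS.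
  have h1 := @level_mass_cvg i (ltnW ltin); have h2 := @level_mass_cvg i.+1 ltin.
  have h3 := IH _ idn'; apply: cvgD; first by apply: cvgMl_tmp; apply: cvgMl_tmp.
  by apply: cvgMl_tmp; apply: cvgD => //; apply: cvgMl_tmp.
- by move=> L /=; ring.
Qed.

End LevelRecursion.

(** * The chain of densities *)

Section Chain.
Variables (R : realType) (n : nat) (tau : nat -> R).
Hypothesis n_gt0 : (0 < n)%N.
Hypothesis tau0 : tau 0 = 1.
Hypothesis taun : tau n = 0.
Hypothesis tau_anti : forall i j, (i <= j <= n)%N -> tau j <= tau i.
Hypothesis tau_lt : forall i, (0 < i < n)%N -> tau i < 1 - i%:R / n%:R.
Implicit Types (A : {set 'I_n}) (w : seq 'I_n) (F G : seq 'I_n -> R).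

Notation s0 := (@finset.set0 'I_n).

Lemma tau_lt1 i : (0 < i <= n)%N -> tau i < 1.
Proof.
case/andP=> i0; rewrite leq_eqVlt => /predU1P[->|ltin]; first by rewrite taun.
apply: lt_le_trans (tau_lt _) _; first by rewrite i0.
by rewrite lerBlDr lerDl divr_ge0.
Qed.

Lemma tau_ge0 i : (i <= n)%N -> 0 <= tau i.
Proof. by move=> le; rewrite -taun tau_anti // le leqnn. Qed.

(* The probability that the element of rank [e + 1] is deleted, [tau i] being the
   probability that none of [i] given queues is selected; it vanishes when the
   letter at position [e] occurred before. *)
Definition hit e w : R := tau (lev s0 (take e w)) - tau (lev s0 (take e.+1 w)).

Lemma hit_ge0 e w : 0 <= hit e w.
Proof. by rewrite subr_ge0 tau_anti // lev_le lev_take_le. Qed.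

Lemma hit_le1 e w : hit e w <= 1.
Proof.
rewrite lerBlDr; apply: le_trans (_ : 1 <= _); last first.
  by rewrite lerDl tau_ge0 // lev_le.
by rewrite -tau0 tau_anti // lev_le.
Qed.

Lemma hit_oversize e w : (size w <= e)%N -> hit e w = 0.
Proof. by move=> h; rewrite /hit !take_oversize ?subrr // ltnW. Qed.

Lemma hit_cat e w u : full w -> hit e (w ++ u) = hit e w.
Proof.
move=> fw; have [ew|we] := ltnP e (size w).
  by rewrite /hit !takel_cat // ltnW.
rewrite [RHS]hit_oversize // /hit.
by rewrite !take_cat !ltnNge we (leq_trans we) //= !lev_full ?subrr ?full_cat.
Qed.

Lemma sum_hit w : full w -> \sum_(e < size w) hit e w = 1.
Proof.
move=> fw; rewrite -(big_mkord xpredT (fun e => hit e w)).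
rewrite (telescope_sumr_eq (fun e => - tau (lev s0 (take e w)))) //; last first.
  by move=> e _; rewrite /hit opprK addrC.
by rewrite take_size take0 lev_full // lev_nil cards0 taun tau0 oppr0 add0r opprK.
Qed.

(* [hit j (ins j q w)], the probability that deleting from [ins j q w] yields [w]. *)
Definition jump j q w : R :=
  tau (lev s0 (take j w)) - tau (lev s0 (rcons (take j w) q)).

Lemma jump_ge0 j q w : 0 <= jump j q w.
Proof. by rewrite subr_ge0 tau_anti // lev_le lev_rcons_le. Qed.

Lemma jump0 q w : jump 0 q w = 1 - tau 1.
Proof.
rewrite /jump take0 /= lev_nil cards0 tau0 lev_cons lev_nil.
by rewrite finset.setU0 cards1.
Qed.

Lemma jump_mem j q w : q \in take j w -> jump j q w = 0.
Proof. by move=> qw; rewrite /jump lev_rcons_mem // subrr. Qed.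

(** If [F] is the density before a deletion, this is the density after it: the deleted letter was
    [q] with probability 1 / n and stood at some position [j]. *)
Definition preimage_sum F w : R :=
  n%:R^-1 * \sum_(q < n) \sum_(j < (size w).+1) jump j q w * F (ins j q w).

(** Words that are not full get 0, which keeps the result stable; no mass is lost in the limit, by
    [lim_mean_push]. *)
Definition push F w : R := if full w then preimage_sum F w else 0.

(* Duality: [preimage_sum] is adjoint to deletion for the uniform measure on words. *)
Lemma mean_preimage_sum L F G :
  mean L (fun w => preimage_sum F w * G w) =
  mean L.+1 (fun w => F w * \sum_(j < L.+1) hit j w * G (del j w)).
Proof.
under [RHS]eq_mean do rewrite mulr_sumr.
rewrite mean_sum //.
under [RHS]eq_bigr => j _ do rewrite (mean_ins _ (ltn_ord j : (j <= L)%N)).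
rewrite -mulr_sumr exchange_big /=.
under eq_bigr => q _ do rewrite -mean_sum //.
rewrite -mean_sum // -meanZ; apply: eq_mean => w sw.
rewrite /preimage_sum -mulrA; congr (_ * _); rewrite mulr_suml; apply: eq_bigr => q _.
rewrite mulr_suml sw; apply: eq_bigr => j _.
have jw : (j <= size w)%N by rewrite sw -ltnS.
by rewrite del_ins // /hit take_ins // takeS_ins // mulrCA mulrA.
Qed.

Lemma preimage_sum_ge0 F w : (forall u, 0 <= F u) -> 0 <= preimage_sum F w.
Proof.
move=> F0; rewrite mulr_ge0 ?invr_ge0 ?ler0n // !sumr_ge0 // => q _.
by rewrite sumr_ge0 // => j _; rewrite mulr_ge0 ?jump_ge0.
Qed.

Lemma push_ge0 F w : (forall u, 0 <= F u) -> 0 <= push F w.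
Proof. by rewrite /push; case: ifP => // _; exact: preimage_sum_ge0. Qed.

Lemma pushD F G w : push (fun u => F u + G u) w = push F w + push G w.
Proof.
rewrite /push; case: ifP => _; last by rewrite addr0.
rewrite /preimage_sum -mulrDr -big_split /=; congr (_ * _).
apply: eq_bigr => q _; rewrite -big_split /=; apply: eq_bigr => j _.
by rewrite mulrDr.
Qed.

Lemma pushZ a F w : push (fun u => a * F u) w = a * push F w.
Proof.
rewrite /push; case: ifP => _; last by rewrite mulr0.
rewrite /preimage_sum mulrCA; congr (_ * _); rewrite mulr_sumr.
apply: eq_bigr => q _; rewrite mulr_sumr; apply: eq_bigr => j _.
by rewrite mulrCA.
Qed.

Lemma eq_push F G : F =1 G -> push F =1 push G.
Proof.
move=> FG w; rewrite /push /preimage_sum; case: ifP => // _; congr (_ * _).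
by apply: eq_bigr => q _; apply: eq_bigr => j _; rewrite FG.
Qed.

Lemma pushB F G w : push (fun u => F u - G u) w = push F w - push G w.
Proof.
rewrite -[- push G w]mulN1r -pushZ -pushD.
by apply: eq_push => u; rewrite mulN1r.
Qed.

Lemma ler_push F G w : (forall u, F u <= G u) -> push F w <= push G w.
Proof.
by move=> FG; rewrite -subr_ge0 -pushB push_ge0 // => u; rewrite subr_ge0.
Qed.

(** A letter inserted behind a full prefix is a repetition and has [jump] 0, so insertions further
    inside [v] do not count. *)
Lemma push_stable F : stable F -> stable (push F).
Proof.
move=> [F1 F2]; split=> [w /negbTE nf|w v fw]; first by rewrite /push nf.
rewrite /push full_cat // fw /preimage_sum; congr (_ * _); apply: eq_bigr => q _.
rewrite size_cat -addSn big_split_ord /= [X in _ + X]big1 ?addr0 => [|i _].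
  apply: eq_bigr => j _; have jw : (j <= size w)%N by rewrite -ltnS.
  have -> : jump j q (w ++ v) = jump j q w by rewrite /jump takel_cat.
  by rewrite -(F2 _ v (full_ins _ _ fw)) /ins takel_cat // drop_cat -catA /=;
     case: ltngtP jw => // -> _; rewrite subnn drop0 drop_size.
rewrite jump_mem ?mul0r // take_cat ltnNge leqW ?leq_addr //= mem_cat.
by move/fullP: fw => ->.
Qed.

(** Duality against the constant 1, as the deletion probabilities of a full word sum to 1. It is an
    inequality because [push] discards words that are not full. *)
Lemma mean_push_le L F : stable F -> (forall u, 0 <= F u) ->
  mean L (push F) <= mean L.+1 F.
Proof.
move=> sF F0; apply: le_trans (_ : mean L (fun w => preimage_sum F w * 1) <= _).
  apply: ler_mean => w _; rewrite mulr1 /push; case: ifP => // _.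
  exact: preimage_sum_ge0.
rewrite mean_preimage_sum; apply: ler_mean => w sw.
under eq_bigr do rewrite mulr1.
have [fw|nfw] := boolP (full w); last by rewrite sF.1 // mul0r.
by rewrite -sw sum_hit // mulr1.
Qed.

(* Inserting at the front is always possible; it makes the chain forget its past. *)
Lemma push_front F w : (forall u, 0 <= F u) -> full w ->
  (1 - tau 1) * (n%:R^-1 * \sum_q F (q :: w)) <= push F w.
Proof.
move=> F0 fw; rewrite /push fw mulrCA; apply: ler_wpM2l; first by rewrite invr_ge0.
rewrite mulr_sumr; apply: ler_sum => q _; rewrite big_ord_recl jump0 /ins take0 drop0.
by rewrite lerDl sumr_ge0 // => j _; rewrite mulr_ge0 ?jump_ge0.
Qed.

(** Keeping the front insertion at each of the [m] steps puts a uniform word [u] before [w]. If [u]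
    is full then [F (u ++ w) = F u], so the bound is independent of [w]. *)
Lemma iter_push_front m F w : stable F -> (forall u, 0 <= F u) -> full w ->
  (1 - tau 1) ^+ m * mean m F <= iter m push F w.
Proof.
move=> sF F0 fw.
have t1 : 0 <= 1 - tau 1 by rewrite subr_ge0 ltW // tau_lt1.
apply: le_trans (_ : (1 - tau 1) ^+ m * mean m (fun u => F (u ++ w)) <= _).
  apply: ler_wpM2l; first exact: exprn_ge0.
  apply: ler_mean => u _; have [fu|nfu] := boolP (full u); first by rewrite sF.2.
  by rewrite sF.1.
elim: m w fw => [|m IH] w fw; first by rewrite expr0 mul1r.
apply: le_trans (push_front _ fw); last first.
  by elim: {IH} m => [|m IH] //= u; exact: push_ge0.
rewrite exprS -mulrA; apply: ler_wpM2l => //.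
(* The outermost [push] inserts the letter next to [w], which is the last letter of the prefix. *)
rewrite (mean_ins _ (leqnn m)) mulrCA; apply: ler_wpM2l; first by rewrite invr_ge0.
rewrite mulr_sumr; apply: ler_sum => q _.
have fqw : full (q :: w) by apply/fullP => x; rewrite inE (fullP _ fw) orbT.
apply: le_trans (IH _ fqw); apply: ler_wpM2l; first exact: exprn_ge0.
apply: ler_mean => u su; rewrite /ins -su take_size drop_size.
by rewrite -catA.
Qed.

(** * The stationary density *)

Definition isig i : R := (1 - tau i)^-1.

Lemma isign : isig n = 1.
Proof. by rewrite /isig taun subr0 invr1. Qed.

Lemma isig_gt0 i : (0 < i <= n)%N -> 0 < isig i.
Proof. by move=> h; rewrite invr_gt0 subr_gt0 tau_lt1. Qed.

(* Level-shifted form of stationarity; [A] is the set of queues met before [w]. *)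
Lemma wt_insertions A q w : q \notin A -> q \in w ->
  \sum_(j < (size w).+1)
    (tau (lev A (take j w)) - tau (lev A (rcons (take j w) q))) *
      wt isig A (ins j q w) =
  wt isig A w - (1 - tau #|A|) * wt isig (q |: A) w.
Proof.
elim: w A => [|x w IH] A // qA; rewrite inE => qxw.
have sub1 (B : {set 'I_n}) : (0 < #|B|)%N -> (1 - tau #|B|) * isig #|B| = 1.
  move=> B0; rewrite /isig divff // gt_eqF // subr_gt0 tau_lt1 //.
  by rewrite B0 card_ord_set_le.
have qA1 : (0 < #|q |: A|)%N by rewrite cardU1_notin.
rewrite big_ord_recl /= lev_nil lev_cons lev_nil (negbTE qA) mul1r.
set p := #|q |: A|; set a := #|A|.
have step j : tau (lev A (take (bump 0 j) (x :: w))) -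
    tau (lev A (rcons (take (bump 0 j) (x :: w)) q)) =
    tau (lev (x |: A) (take j w)) - tau (lev (x |: A) (rcons (take j w) q)).
  by rewrite /bump /= !lev_cons.
under eq_bigr => j _ do rewrite step /= mulrCA.
rewrite -mulr_sumr.
have [eqx|neqx] := eqVneq q x.
  (* Behind an occurrence of [q], a further [q] is a repetition and cannot be deleted; only the
     insertion in front counts. *)
  subst x; rewrite big1 ?mulr0 ?addr0 => [|j _]; last first.
    rewrite (_ : lev _ (rcons _ _) = lev (q |: A) (take j w)) ?subrr ?mul0r //.
    rewrite /lev; congr #|pred_of_set _|; apply/setP => y.
    by rewrite !inE mem_rcons inE; case: eqP.
  rewrite (negbTE qA) mul1r !inE eqxx /= (_ : q |: (q |: A) = q |: A); last first.
    by rewrite finset.setUA finset.setUid.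
  set W := wt _ _ w; transitivity ((1 - tau p) * isig p * W -
    (1 - tau a) * (isig p * W)); first by ring.
  by rewrite sub1 // mul1r.
have qw : q \in w by move: qxw; rewrite (negbTE neqx).
rewrite IH //; last by rewrite !inE negb_or neqx.
rewrite !inE (eq_sym x) (negbTE neqx) /= (finset.setUCA [set x]).
(* A repeated [x] has weight [isig a], which cancels the factor [1 - tau a] of the induction
   hypothesis. A new [x] raises the level, and the terms telescope. *)
have [xA|xA] := boolP (x \in A).
  have -> : x |: A = A by apply/finset.setUidPr; rewrite finset.sub1set.
  rewrite -/a.
  have := sub1 _ qA1; rewrite -/p => hp.
  have := sub1 A; rewrite -/a card_gt0 => ha.
  have {}ha : (1 - tau a) * isig a = 1 by apply: ha; apply/set0Pn; exists x.
  rewrite mulrBr; rewrite [isig a * (_ * _)]mulrA [isig a * (1 - _)]mulrC ha.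
  set U := wt _ (q |: A) w; set W := wt _ A w.
  transitivity (isig a * W - (1 - tau a) * (isig p * U) +
    ((1 - tau p) * isig p - 1) * U); first by ring.
  by rewrite hp subrr mul0r addr0.
rewrite !mul1r (cardU1_notin xA) /p (cardU1_notin qA) -/a.
ring.
Qed.

(** For the empty set the correction term of [wt_insertions] vanishes, as [tau 0 = 1]; each of the
    [n] letters then contributes the same amount. *)
Lemma push_wt w : push (wt isig s0) w = wt isig s0 w.
Proof.
rewrite /push; case: ifP => [fw|/negbT nfw]; last by rewrite (wt_stable isign).1.
rewrite /preimage_sum (eq_bigr (fun=> wt isig s0 w)) => [|q _].
  by rewrite sumr_const card_ord -[wt _ _ _ *+ n]mulr_natl mulKf // pnatr_eq0 -lt0n.
rewrite /jump wt_insertions ?(fullP _ fw) ?inE //.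
by rewrite cards0 tau0 subrr mul0r subr0.
Qed.

Notation fr i := (i%:R / n%:R : R).

(** This is the stability condition sigma_i > i / n: the geometric weights of the repetitions at
    level [i] have a finite sum. *)
Lemma rho_isig_lt1 i : (i < n)%N -> 0 <= fr i * isig i < 1.
Proof.
case: i => [|i] ltin; first by rewrite !mul0r lexx ltr01.
have t1 : 0 < 1 - tau i.+1.
  by rewrite subr_gt0; apply: tau_lt1; rewrite (ltnW ltin).
rewrite mulr_ge0 ?divr_ge0 ?invr_ge0 ?(ltW t1) //= ltr_pdivrMr // mul1r.
have := tau_lt (ltin : (0 < i.+1 < n)%N); lra.
Qed.

Definition z0 : R := \prod_(0 <= l < n) ((1 - fr l) / (1 - fr l * isig l)).

Lemma z0_gt0 : 0 < z0.
Proof.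
rewrite /z0 big_seq_cond; apply: prodr_gt0 => l; rewrite andbT mem_index_iota /= => ln.
rewrite divr_gt0 // subr_gt0; last by case/andP: (rho_isig_lt1 ln).
by rewrite ltr_pdivrMr ?ltr0n // mul1r ltr_nat.
Qed.

(* The stationary density with respect to the uniform measure on words. *)
Definition psi w : R := z0^-1 * wt isig s0 w.

Lemma psi_stable : stable psi.
Proof. exact/stableZ/wt_stable/isign. Qed.

Lemma psi_ge0 w : 0 <= psi w.
Proof.
rewrite mulr_ge0 ?invr_ge0 ?(ltW z0_gt0) //.
have [/fullP fw|nfw] := boolP (full w); last by rewrite (wt_stable isign).1.
by apply/ltW/wt_gt0 => [i|q]; [exact: isig_gt0|rewrite fw orbT].
Qed.

Lemma push_psi w : push psi w = psi w.
Proof. by rewrite pushZ push_wt. Qed.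

Lemma mean_psi_cvg : mean L psi @[L --> \oo] --> (1 : R).
Proof.
rewrite -(mulVf (lt0r_neq0 z0_gt0)).
under eq_cvg do rewrite meanZ mean_wt // cards0.
apply: cvgMl_tmp; exact: (level_mass_cvg n_gt0 isign rho_isig_lt1 (leq0n n)).
Qed.

Lemma mean_psi_le1 L : mean L psi <= 1.
Proof.
rewrite -(cvg_lim (@Rhausdorff R) mean_psi_cvg); apply: nondecreasing_cvgn_le.
  by move=> i j ij; apply: mean_nondecreasing => //; [exact: psi_stable|exact: psi_ge0].
by apply/cvg_ex; exists 1; exact: mean_psi_cvg.
Qed.

(** * Functions dominated by the stationary density and their limit means *)

Definition dominated C F := stable F /\ forall w, `|F w| <= C * psi w.

Definition lim_mean F := limn (fun L => mean L F).

Lemma ge0_mean_cvg C F : dominated C F -> (forall w, 0 <= F w) ->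
  mean L F @[L --> \oo] --> lim_mean F.
Proof.
move=> [sF dF] F0; apply: nondecreasing_is_cvgn.
  by move=> i j ij; exact: mean_nondecreasing.
exists `|C| => _ [L _ <-]; apply: (le_trans (ler_norm _)).
apply: le_trans (ler_norm_mean _ _) _.
apply: le_trans (ler_mean (fun w _ => dF w)) _; rewrite meanZ.
apply: le_trans (ler_norm _) _; rewrite normrM ler_piMr // ger0_norm ?mean_psi_le1 //.
by apply: mean_ge0 => // w _; exact: psi_ge0.
Qed.

Lemma dominatedD C C' F G : dominated C F -> dominated C' G ->
  dominated (C + C') (fun w => F w + G w).
Proof.
move=> [sF dF] [sG dG]; split=> [|w]; first exact: stableD.
by rewrite mulrDl (le_trans (ler_normD _ _)) // lerD.
Qed.

Lemma dominatedZ a C F : dominated C F -> dominated (`|a| * C) (fun w => a * F w).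
Proof.
move=> [sF dF]; split=> [|w]; first exact: stableZ.
by rewrite normrM -mulrA ler_wpM2l.
Qed.

Lemma dominatedB C C' F G : dominated C F -> dominated C' G ->
  dominated (C + C') (fun w => F w - G w).
Proof.
move=> [sF dF] [sG dG]; split=> [|w]; first exact: stableB.
by rewrite mulrDl (le_trans (ler_normB _ _)) // lerD.
Qed.

Lemma dominated_norm C F : dominated C F -> dominated C (fun w => `|F w|).
Proof.
move=> [sF dF]; split=> [|w]; last by rewrite normr_id.
exact: (stable_comp (h := fun x => `|x|) (normr0 _)).
Qed.

Lemma dominated_psi : dominated 1 psi.
Proof. by split=> [|w]; [exact: psi_stable|rewrite mul1r ger0_norm ?psi_ge0]. Qed.

Lemma dominatedM C F (r : seq 'I_n -> R) : dominated C F ->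
  (forall w v, full w -> r (w ++ v) = r w) -> (forall w, `|r w| <= 1) ->
  dominated C (fun w => F w * r w).
Proof.
move=> [sF dF] rc r1; split=> [|w]; first exact: stableM.
by rewrite normrM (le_trans _ (dF w)) // ler_piMr.
Qed.

Lemma norm_push_le F w : `|push F w| <= push (fun u => `|F u|) w.
Proof.
rewrite ler_norml -[- push _ w]mulN1r -pushZ !ler_push // => u.
  exact: ler_norm.
by rewrite mulN1r lerNl ler_normr lexx orbT.
Qed.

(** [push] is positive and fixes [psi], so it preserves a bound by a multiple of [psi]; one constant
    serves for all times. *)
Lemma dominated_push C F : dominated C F -> dominated C (push F).
Proof.
move=> [sF dF]; split=> [|w]; first exact: push_stable.
by rewrite -(push_psi w) -pushZ (le_trans (norm_push_le _ _)) // ler_push.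
Qed.

(** Adding [C * psi] makes the function nonnegative, which reduces to monotone convergence. *)
Lemma mean_cvg C F : dominated C F -> mean L F @[L --> \oo] --> lim_mean F.
Proof.
move=> dF; have dG := dominatedD dF (dominatedZ C dominated_psi).
have cG := ge0_mean_cvg dG.
have /cG {}cG : forall w, 0 <= F w + C * psi w.
  move=> w; have [_ /(_ w)] := dF; rewrite ler_norml; lra.
suff: cvgn (fun L => mean L F) by [].
apply/cvg_ex; exists (lim_mean (fun w => F w + C * psi w) - C * 1).
have -> : (fun L => mean L F) = (fun L => mean L (fun w => F w + C * psi w) - C * mean L psi).
  by apply/funext => L; rewrite meanD meanZ addrK.
by apply: cvgB => //; apply: cvgMl_tmp; exact: mean_psi_cvg.
Qed.

Lemma lim_meanE F (l : R) : mean L F @[L --> \oo] --> l -> lim_mean F = l.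
Proof. exact: cvg_lim. Qed.

Lemma lim_meanD C C' F G : dominated C F -> dominated C' G ->
  lim_mean (fun w => F w + G w) = lim_mean F + lim_mean G.
Proof.
move=> dF dG; apply: lim_meanE; under eq_cvg do rewrite meanD.
by apply: cvgD; [exact: mean_cvg dF|exact: mean_cvg dG].
Qed.

Lemma lim_meanZ a C F : dominated C F ->
  lim_mean (fun w => a * F w) = a * lim_mean F.
Proof.
move=> dF; apply: lim_meanE; under eq_cvg do rewrite meanZ.
by apply: cvgMl_tmp; exact: mean_cvg dF.
Qed.

Lemma lim_meanB C C' F G : dominated C F -> dominated C' G ->
  lim_mean (fun w => F w - G w) = lim_mean F - lim_mean G.
Proof.
move=> dF dG; apply: lim_meanE; under eq_cvg do rewrite meanB.
by apply: cvgB; [exact: mean_cvg dF|exact: mean_cvg dG].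
Qed.

Lemma lim_mean_psi : lim_mean psi = 1.
Proof. by apply: lim_meanE; exact: mean_psi_cvg. Qed.

Lemma lim_mean_le C C' F G : dominated C F -> dominated C' G ->
  (forall w, F w <= G w) -> lim_mean F <= lim_mean G.
Proof.
move=> dF dG FG; apply: ler_cvg_to (mean_cvg dF) (mean_cvg dG) _.
by apply: nearW => L; apply: ler_mean.
Qed.

Lemma ge0_mean_le_lim C F L : dominated C F -> (forall w, 0 <= F w) ->
  mean L F <= lim_mean F.
Proof.
move=> dF F0; apply: nondecreasing_cvgn_le.
  by move=> i j ij; apply: mean_nondecreasing => //; case: dF.
exact: mean_cvg dF.
Qed.

Lemma lim_mean_push_le C F : dominated C F -> lim_mean (push F) <= lim_mean F.
Proof.
move=> dF; have dP := dominatedZ C dominated_psi.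
have dG := dominatedD dF dP.
have G0 w : 0 <= F w + C * psi w.
  have [_ /(_ w)] := dF; rewrite ler_norml; lra.
have : lim_mean (push (fun w => F w + C * psi w)) <= lim_mean (fun w => F w + C * psi w).
  have cG : mean L.+1 (fun w => F w + C * psi w) @[L --> \oo] -->
            lim_mean (fun w => F w + C * psi w).
    by rewrite (cvg_shiftS (fun L => mean L (fun w => F w + C * psi w))); exact: mean_cvg dG.
  apply: ler_cvg_to (mean_cvg (dominated_push dG)) cG _.
  by apply: nearW => L; apply: mean_push_le => //; case: dG.
rewrite (lim_meanD dF dP) (_ : push _ = fun w => push F w + C * psi w).
  by rewrite (lim_meanD (dominated_push dF) dP) lerD2r.
by apply/funext => w; rewrite pushD pushZ push_psi.
Qed.

(** The inequality for [F] and for its negative: deletions conserve mass. *)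
Lemma lim_mean_push C F : dominated C F -> lim_mean (push F) = lim_mean F.
Proof.
move=> dF; apply/eqP; rewrite eq_le (lim_mean_push_le dF) /=.
have := lim_mean_push_le (dominatedZ (-1) dF).
rewrite (lim_meanZ _ dF) (_ : push _ = fun w => -1 * push F w).
  by rewrite (lim_meanZ _ (dominated_push dF)) !mulN1r lerN2.
by apply/funext => w; rewrite pushZ.
Qed.

(** The means of the nonnegative function [F + C * psi] increase to their limit. The error bound
    depends on [C] and [L] alone. *)
Lemma lim_mean_tail C F L : dominated C F ->
  mean L F - lim_mean F <= C * (1 - mean L psi).
Proof.
move=> dF; have dP := dominatedZ C dominated_psi.
have G0 w : 0 <= F w + C * psi w.
  have [_ /(_ w)] := dF; rewrite ler_norml; lra.
have := ge0_mean_le_lim L (dominatedD dF dP) G0.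
rewrite (lim_meanD dF dP) (lim_meanZ _ dominated_psi) lim_mean_psi meanD meanZ.
lra.
Qed.

(** * Convergence to the stationary density *)

Lemma dominated_iter C F m : dominated C F -> dominated C (iter m push F).
Proof. by move=> dF; elim: m => //= m; exact: dominated_push. Qed.

Lemma lim_mean_iter C F m : dominated C F -> lim_mean (iter m push F) = lim_mean F.
Proof.
move=> dF; elim: m => //= m IH.
by rewrite (lim_mean_push (dominated_iter m dF)).
Qed.

Lemma iter_pushD m F G w :
  iter m push (fun u => F u + G u) w = iter m push F w + iter m push G w.
Proof. by elim: m w => //= m IH w; rewrite -pushD; exact: eq_push. Qed.

Lemma iter_pushB m F G w :
  iter m push (fun u => F u - G u) w = iter m push F w - iter m push G w.
Proof. by elim: m w => //= m IH w; rewrite -pushB; exact: eq_push. Qed.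

Lemma full_dominated : dominated z0 (fun w => (full w)%:R).
Proof.
split=> [|w]; first by split=> [w /negbTE ->|w v fw] //; rewrite full_cat ?fw.
rewrite /psi mulrA divff ?lt0r_neq0 ?z0_gt0 // mul1r.
case: (boolP (full w)) => fw; last by rewrite normr0 (wt_stable isign).1.
rewrite normr1; apply: wt_ge1 => [i i0|q]; last by rewrite (fullP _ fw) orbT.
rewrite -invr1 lef_pV2 ?posrE ?subr_gt0 ?tau_lt1 //.
by rewrite gerBl tau_ge0 //; case/andP: i0.
Qed.

(** With unit weights the product in [level_mass_cvg] is 1: a uniform infinite word almost surely
    contains every letter. *)
Lemma lim_mean_full : lim_mean (fun w => (full w)%:R) = 1.
Proof.
apply: lim_meanE.
have e1 : \prod_(0 <= l < n) ((1 - fr l) / (1 - fr l * 1)) = 1.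
  rewrite big_seq_cond big1 // => l; rewrite andbT mem_index_iota /= => ln.
  rewrite mulr1 divff // gt_eqF // subr_gt0.
  by rewrite ltr_pdivrMr ?ltr0n // mul1r ltr_nat.
have r1 i : (i < n)%N -> 0 <= fr i * 1 < 1.
  by move=> ln; rewrite mulr1 divr_ge0 //= ltr_pdivrMr ?ltr0n // mul1r ltr_nat.
have := level_mass_cvg n_gt0 (erefl : (fun=> 1 : R) n = 1) r1 (leq0n n); rewrite e1.
suff -> : level_mass n (fun=> 1 : R) 0%N = fun L => mean L (fun w => (full w)%:R) by [].
apply/funext => L; rewrite -[X in level_mass _ _ X](cards0 'I_n) -mean_wt //.
by apply: eq_mean => w _; rewrite wt1.
Qed.

(* By [iter_push_front] the positive and negative parts of [g] share a multiple of
   [full] after [m] steps, and this common part cancels. *)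
Lemma contraction C g m : dominated C g -> lim_mean g = 0 ->
  lim_mean (fun w => `|iter m push g w|) <=
  (1 - (1 - tau 1) ^+ m) * lim_mean (fun w => `|g w|) +
  2 * (1 - tau 1) ^+ m * C * (1 - mean m psi).
Proof.
move=> dg g0; set p := (1 - tau 1) ^+ m; set u := lim_mean (fun w => `|g w|).
have dn := dominated_norm dg.
set gp := fun w => 2^-1 * (`|g w| + g w); set gm := fun w => 2^-1 * (`|g w| - g w).
have dp : dominated _ gp := dominatedZ 2^-1 (dominatedD dn dg).
have dm : dominated _ gm := dominatedZ 2^-1 (dominatedB dn dg).
have gp0 w : 0 <= gp w.
  by have := ler_norm (- g w); rewrite normrN /gp; lra.
have gm0 w : 0 <= gm w by rewrite mulr_ge0 ?invr_ge0 // subr_ge0 ler_norm.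
(* As [lim_mean g = 0], both parts have mass [u / 2]; up to the tail error this much is seen within
   [m] letters. *)
set a := u / 2 - C * (1 - mean m psi).
have h1 := lim_mean_tail m (dominatedZ (-1) dg).
have h2 := lim_mean_tail m dg.
have h3 := lim_mean_tail m (dominatedZ (-1) dn).
rewrite (lim_meanZ _ dg) (meanZ _ (-1)) g0 normrN1 mul1r in h1.
rewrite g0 in h2.
rewrite (lim_meanZ _ dn) (meanZ _ (-1)) normrN1 mul1r -/u in h3.
have ap : a <= mean m gp by rewrite /gp meanZ meanD /a; lra.
have am : a <= mean m gm by rewrite /gm meanZ meanB /a; lra.
have p0 : 0 <= p by rewrite exprn_ge0 // subr_ge0 ltW // tau_lt1.
(* On full words both parts P and Q are at least p a after [m] steps, so that |P - Q| <= P + Q - 2 p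
   a. *)
have key w : `|iter m push g w| <=
    iter m push (fun w => `|g w|) w - 2 * p * a * (full w)%:R.
  case: (boolP (full w)) => fw; last first.
    rewrite mulr0 subr0 (dominated_iter m dg).1.1 // normr0.
    by rewrite (dominated_iter m dn).1.1.
  have e1 : iter m push (fun w => `|g w|) w = iter m push gp w + iter m push gm w.
    rewrite -iter_pushD; congr (iter m push _ w); apply/funext => u'.
    by rewrite /gp /gm; lra.
  have e2 : iter m push g w = iter m push gp w - iter m push gm w.
    rewrite -iter_pushB; congr (iter m push _ w); apply/funext => u'.
    by rewrite /gp /gm; lra.
  have l1 := iter_push_front m dp.1 gp0 fw.
  have l2 := iter_push_front m dm.1 gm0 fw.
  have l3 := ler_wpM2l p0 ap; have l4 := ler_wpM2l p0 am.
  rewrite -/p in l1 l2.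
  rewrite mulr1 e1 e2 ler_norml; lra.
have dfull := dominatedZ (2 * p * a) full_dominated.
have := lim_mean_le (dominated_norm (dominated_iter m dg))
  (dominatedB (dominated_iter m dn) dfull) key.
rewrite (lim_meanB (dominated_iter m dn) dfull) (lim_meanZ _ full_dominated).
rewrite lim_mean_full (lim_mean_iter _ dn) -/u mulr1 => /le_trans; apply.
rewrite /a; lra.
Qed.

(* The density after [s] deletions with respect to the uniform measure on words. *)
Definition phi s := iter s push (fun w => (full w)%:R).

Lemma phi_dominated s : dominated z0 (phi s).
Proof. exact/dominated_iter/full_dominated. Qed.

Lemma phi_sub_psi s m w :
  phi (m + s) w - psi w = iter m push (fun w => phi s w - psi w) w.
Proof.
rewrite iter_pushB /phi iterD; congr (_ - _).
by elim: m w => //= m IH w; rewrite -{1}push_psi; exact: eq_push.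
Qed.

Lemma phi_cvg_psi : lim_mean (fun w => `|phi s w - psi w|) @[s --> \oo] --> (0 : R).
Proof.
set u := fun s => lim_mean (fun w => `|phi s w - psi w|).
have dg s : dominated (z0 + 1) (fun w => phi s w - psi w).
  exact: dominatedB (phi_dominated s) dominated_psi.
have g0 s : lim_mean (fun w => phi s w - psi w) = 0.
  rewrite (lim_meanB (phi_dominated s) dominated_psi) lim_mean_psi.
  by rewrite (lim_mean_iter _ full_dominated) lim_mean_full subrr.
have u0 s : 0 <= u s.
  apply: le_trans (ge0_mean_le_lim 0 (dominated_norm (dg s)) _) => //.
  exact: mean_ge0.
(* Positivity and conservation of mass make the L1 distance nonincreasing. *)
have udec : {homo u : i j / (i <= j)%N >-> j <= i}.
  apply/nonincreasing_seqP => s.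
  rewrite /u -(lim_mean_push (dominated_norm (dg s))).
  apply: lim_mean_le (dominated_norm (dg s.+1)) (dominated_push (dominated_norm (dg s))) _.
  move=> w; apply: le_trans (norm_push_le _ _).
  by rewrite (phi_sub_psi s 1).
have cu : u @ \oo --> limn u.
  apply: nonincreasing_is_cvgn => //.
  by exists 0 => _ [s _ <-].
suff -> : 0 = limn u by [].
apply/eqP; rewrite eq_le; apply/andP; split.
  by apply: limr_ge; [exact: cu|exact: nearW].
(* Letting [s] grow in [contraction] with [m] fixed puts the limit on both sides, and the factor [p]
   cancels. The bound then vanishes as [m] grows. *)
have bnd m : limn u <= 2 * (z0 + 1) * (1 - mean m psi).
  set p := (1 - tau 1) ^+ m.
  have p0 : 0 < p by rewrite exprn_gt0 // subr_gt0 tau_lt1.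
  have c1 : u (s + m)%N @[s --> \oo] --> limn u by rewrite cvg_shiftn.
  have c2 : (1 - p) * u s + 2 * p * (z0 + 1) * (1 - mean m psi) @[s --> \oo] -->
      (1 - p) * limn u + 2 * p * (z0 + 1) * (1 - mean m psi).
    by apply: cvgD; [exact: cvgMl_tmp|exact: cvg_cst].
  have : limn u <= (1 - p) * limn u + 2 * p * (z0 + 1) * (1 - mean m psi).
    apply: ler_cvg_to c1 c2 _; apply: nearW => s.
    have -> : u (s + m)%N = lim_mean (fun w => `|iter m push (fun w => phi s w - psi w) w|).
      by rewrite /u addnC; congr lim_mean; apply/funext => w; rewrite phi_sub_psi.
    exact: contraction.
  move=> h; rewrite -(ler_pM2l p0); lra.
have c3 : 2 * (z0 + 1) * (1 - mean m psi) @[m --> \oo] --> 2 * (z0 + 1) * (1 - 1).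
  by apply: cvgMl_tmp; apply: cvgB; [exact: cvg_cst|exact: mean_psi_cvg].
rewrite subrr mulr0 in c3.
by apply: (ler_cvg_to (cvg_cst _) c3); exact: nearW.
Qed.

(** * The limit law of the rank error and its mean *)

Lemma hit_norm_le1 e w : `|hit e w| <= 1.
Proof. by rewrite ger0_norm ?hit_le1 ?hit_ge0. Qed.

Definition pE e := lim_mean (fun w => psi w * hit e w).

Lemma dominated_hit C F e : dominated C F -> dominated C (fun w => F w * hit e w).
Proof.
by move=> dF; apply: dominatedM => // [w v fw|w]; [exact: hit_cat|exact: hit_norm_le1].
Qed.

Lemma pE_ge0 e : 0 <= pE e.
Proof.
apply: le_trans (ge0_mean_le_lim 0 (dominated_hit e dominated_psi) _).
  by apply: mean_ge0 => // w _; rewrite mulr_ge0 ?psi_ge0 ?hit_ge0.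
by move=> w; rewrite mulr_ge0 ?psi_ge0 ?hit_ge0.
Qed.

(** [hit] is at most 1, so the error is bounded by the L1 distance of the densities. *)
Lemma law_cvg_pE e :
  lim_mean (fun w => phi s w * hit e w) @[s --> \oo] --> pE e.
Proof.
apply/cvgrPdist_le => eps eps0.
have [N _ HN] : \forall s \near \oo, `|0 - lim_mean (fun w => `|phi s w - psi w|)| <= eps.
  by have /cvgrPdist_le := phi_cvg_psi; exact.
exists N => // s Ns; have := HN s Ns; rewrite sub0r normrN.
have dg : dominated (z0 + 1) (fun w => phi s w - psi w).
  exact: dominatedB (phi_dominated s) dominated_psi.
move=> /(le_trans (ler_norm _)); apply: le_trans; rewrite distrC.
rewrite /pE -(lim_meanB (dominated_hit e (phi_dominated s)) (dominated_hit e dominated_psi)).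
have -> : (fun w => phi s w * hit e w - psi w * hit e w) =
    (fun w => (phi s w - psi w) * hit e w) by apply/funext => w; rewrite mulrBl.
have dgh := dominated_hit e dg.
have b w : `|(phi s w - psi w) * hit e w| <= `|phi s w - psi w|.
  by rewrite normrM ler_piMr // hit_norm_le1.
rewrite ler_norml; apply/andP; split; last first.
  apply: lim_mean_le dgh (dominated_norm dg) _ => w.
  exact: le_trans (ler_norm _) (b w).
rewrite -mulN1r -(lim_meanZ (-1) (dominated_norm dg)).
apply: lim_mean_le (dominatedZ (-1) (dominated_norm dg)) dgh _ => w.
by rewrite mulN1r lerNl (le_trans _ (b w)) // ler_normr lexx orbT.
Qed.

(** Exchanges the sum over [e] with the limit over word lengths; all terms are nonnegative. *)
Lemma sum_pE_cvg (b : nat -> R) (y : R) : (forall e, 0 <= b e) ->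
  mean L (fun w => psi w * \sum_(e < size w) b e * hit e w) @[L --> \oo] --> y ->
  \sum_(0 <= e < K) b e * pE e @[K --> \oo] --> y.
Proof.
move=> b0 cy.
set Fk := fun K w => \sum_(0 <= e < K) b e * (psi w * hit e w).
have t0 e w : 0 <= b e * (psi w * hit e w) by rewrite mulr_ge0 // mulr_ge0 ?psi_ge0 ?hit_ge0.
have dFk K : {C | dominated C (Fk K)}.
  elim: K => [|K [C dC]].
    exists 0; split=> [|w]; last by rewrite /Fk big_geq // normr0 mul0r.
    by split=> [w _|w v _]; rewrite /Fk !big_geq.
  exists (C + `|b K| * 1).
  rewrite (_ : Fk K.+1 = fun w => Fk K w + b K * (psi w * hit K w)).
    exact/dominatedD/dominatedZ/dominated_hit/dominated_psi.
  by apply/funext => w; rewrite /Fk big_nat_recr.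
have limFk K : lim_mean (Fk K) = \sum_(0 <= e < K) b e * pE e.
  apply: lim_meanE; under eq_cvg do rewrite /Fk mean_sum //.
  apply: cvg_big => [|e _]; first exact: add_continuous.
  under eq_cvg do rewrite meanZ.
  by apply: cvgMl_tmp; exact: mean_cvg (dominated_hit e dominated_psi).
have Fk0 K w : 0 <= Fk K w by apply: sumr_ge0.
have FkE w : psi w * (\sum_(e < size w) b e * hit e w) = Fk (size w) w.
  by rewrite mulr_sumr /Fk big_mkord; apply: eq_bigr => e _; rewrite mulrCA.
have Fk_le K w : Fk K w <= Fk (size w) w.
  have [h|h] := leqP K (size w).
    by rewrite /Fk (big_cat_nat _ h) //= lerDl sumr_ge0.
  rewrite /Fk (big_cat_nat (n := size w)) // ?(ltnW h) //= gerDl.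
  rewrite big_nat_cond big1 // => e; rewrite andbT => /andP[he _].
  by rewrite hit_oversize // !mulr0.
(* Below: a word of length [K] involves only the first [K] summands. Above: truncating the sum at
   [K] can only lower it. *)
apply: (@squeeze_cvgr _ _ _ _ (fun L => mean L (fun w =>
  psi w * \sum_(e < size w) b e * hit e w)) (fun=> y)) => //; last exact: cvg_cst.
apply: nearW => K; rewrite -limFk; have [C dC] := dFk K; apply/andP; split.
  apply: le_trans (ge0_mean_le_lim K dC (Fk0 K)).
  by apply: ler_mean => w <-; rewrite FkE.
apply: ler_cvg_to (mean_cvg dC) cy _; apply: nearW => L.
by apply: ler_mean => w _; rewrite FkE.
Qed.

Lemma sum_pE1 : \sum_(0 <= e < K) pE e @[K --> \oo] --> (1 : R).
Proof.
under eq_cvg do under eq_bigr do rewrite -[pE _]mul1r.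
apply: (sum_pE_cvg (b := fun=> 1)) => //.
rewrite (_ : (fun L => _) = (fun L => mean L psi)); first exact: mean_psi_cvg.
apply/funext => L; apply: eq_mean => w _; under eq_bigr do rewrite mul1r.
have [fw|nfw] := boolP (full w); first by rewrite sum_hit // mulr1.
by rewrite psi_stable.1 // mul0r.
Qed.

Lemma mean_rank_cvg : \sum_(0 <= e < K) e%:R * pE e @[K --> \oo] -->
  \sum_(1 <= l < n) tau l / (1 - fr l * isig l).
Proof.
apply: (sum_pE_cvg (b := fun e => e%:R)) => //.
rewrite (_ : (fun L => _) = (fun L => z0^-1 * level_rank n tau isig 0 L)); last first.
  apply/funext => L; rewrite -(cards0 'I_n) -mean_wt_rankA // -meanZ.
  by apply: eq_mean => w _; rewrite /psi mulrA.
(* The index is shifted in the terms [tau l.+1], with [tau n = 0], and 1 + r / (1 - r) = 1 / (1 -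
   r). *)
have -> : \sum_(1 <= l < n) tau l / (1 - fr l * isig l) =
  z0^-1 * (z0 * \sum_(0 <= l < n)
    (tau l.+1 + fr l * isig l / (1 - fr l * isig l) * tau l)).
  rewrite mulKf ?lt0r_neq0 ?z0_gt0 // big_split /=.
  rewrite -(big_add1 _ _ 0 n.+1 xpredT tau) big_nat_recr //= taun addr0.
  rewrite [X in _ = _ + X]big_ltn // !mul0r add0r -big_split /=.
  rewrite !big_nat; apply: eq_bigr => l /andP[l0 ln].
  have : 1 - fr l * isig l != 0.
    by rewrite subr_eq0 eq_sym lt_eqF //; case/andP: (rho_isig_lt1 ln).
  by move: (fr l * isig l) => r r1; field.
apply: cvgMl_tmp; exact: (level_rank_cvg n_gt0 taun isign rho_isig_lt1 (leq0n n)).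
Qed.

End Chain.

(** * From queues to words *)

Section SumSeq.
Variables (R : realType) (T : finType).

Fixpoint sumseq s (F : seq T -> R) : R :=
  if s is s'.+1 then \sum_(x : T) sumseq s' (fun t => F (x :: t)) else F [::].

Lemma eq_sumseq s F G : (forall t, size t = s -> F t = G t) -> sumseq s F = sumseq s G.
Proof.
elim: s F G => [|s IH] F G FG /=; first exact: FG.
by apply: eq_bigr => x _; apply: IH => t st; apply: FG; rewrite /= st.
Qed.

Lemma sumseq_eq0 s F : (forall t, size t = s -> F t = 0) -> sumseq s F = 0.
Proof.
elim: s F => [|s IH] F F0 /=; first exact: F0.
by apply: big1 => x _; apply: IH => t st; apply: F0; rewrite /= st.
Qed.

Lemma sumseqZ s a F : sumseq s (fun t => a * F t) = a * sumseq s F.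
Proof.
by elim: s F => [|s IH] F //=; rewrite mulr_sumr; apply: eq_bigr => x _; exact: IH.
Qed.

Lemma sum_tuple_sumseq s (F : seq T -> R) : \sum_(t : s.-tuple T) F t = sumseq s F.
Proof.
elim: s F => [|s IH] F /=.
  by rewrite (big_pred1 [tuple]) // => t; apply/esym/eqP; exact: tuple0.
under [RHS]eq_bigr do rewrite -IH.
rewrite pair_bigA /= (reindex (fun p : T * s.-tuple T => [tuple of p.1 :: p.2])) //.
exists (fun t : s.+1.-tuple T => (thead t, [tuple of behead t])).
  by move=> [x t] _; congr pair; exact: val_inj.
by move=> t _; rewrite [RHS]tuple_eta; exact: val_inj.
Qed.

Lemma sum_ffun_sumseq s (F : seq T -> R) :
  \sum_(f : {ffun 'I_s -> T}) F [seq f i | i : 'I_s] = sumseq s F.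
Proof.
rewrite -sum_tuple_sumseq [RHS](reindex (@tuple_of_finfun T s)) //.
exists (@finfun_of_tuple T s) => ? _; [exact: tuple_of_finfunK|exact: finfun_of_tupleK].
Qed.

End SumSeq.

Lemma mean_sumseq (R : realType) n L (F : seq 'I_n -> R) :
  mean L F = (n%:R ^+ L)^-1 * sumseq L F.
Proof.
elim: L F => [|L IH] F /=; first by rewrite expr0 invr1 mul1r.
under eq_bigr do rewrite IH.
by rewrite -mulr_sumr mulrA exprS invfM.
Qed.

Definition selected n k (ch : choiceT n k) : pred 'I_n :=
  fun q => [exists i : 'I_k.+1, ((i < k)%N || ch.1) && (ch.2 i == q)].

Lemma find_selected_lt n k (ch : choiceT n k) w :
  (0 < k)%N -> full w -> (find (selected ch) w < size w)%N.
Proof.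
move=> k0 fw.
rewrite -has_find; apply/hasP; exists (ch.2 (Ordinal (leqW k0))); first exact/fullP.
by apply/existsP; exists (Ordinal (leqW k0)); rewrite /= k0 eqxx.
Qed.

(** * One deletion as the removal of a letter *)

Section Step.
Variables (n k N : nat) (a : {ffun 'I_N -> 'I_n}).
Implicit Types (D : {set 'I_N}) (ch : choiceT n k).

Definition remaining D := [seq j <- enum 'I_N | j \notin D].
(** Queue labels of the remaining elements in increasing order: the position of a letter is the rank
    error of deleting its element. *)
Definition word D := [seq a j | j <- remaining D].

Lemma full_word D :
  full (word D) = [forall q : 'I_n, [exists j : 'I_N, (a j == q) && (j \notin D)]].
Proof.
apply: eq_forallb => q; apply/mapP/existsP => [[j + ->]|[j /andP[/eqP <- jD]]].
  by rewrite mem_filter => /andP[jD _]; exists j; rewrite eqxx.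
by exists j; rewrite // mem_filter jD mem_enum.
Qed.

Lemma remaining_sorted D : pairwise (fun i j : 'I_N => (i < j)%N) (remaining D).
Proof.
apply: pairwise_filter; have := iota_ltn_sorted 0 N; rewrite -val_enum_ord.
by rewrite sorted_pairwise ?pairwise_map //; exact: ltn_trans.
Qed.

Lemma mq_step_word D ch : (0 < k)%N -> full (word D) ->
  exists2 D', mq_step a D ch = Some (find (selected ch) (word D), D')
    & word D' = del (find (selected ch) (word D)) (word D).
Proof.
move=> k0 fw; set sel := selected ch; set m := find sel _.
have hs : has (preim a sel) (remaining D).
  by rewrite -has_map has_find find_selected_lt.
(* Cut at the first selected letter: [u] lists the remaining elements smaller than [j0], none of
   them in a selected queue. *)
have [j0 [u [v [rE uN j0s mE]]]] : exists j0 u v, [/\ remaining D = u ++ j0 :: v,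
    ~~ has (preim a sel) u, sel (a j0) & m = size u].
  have fm : m = find (preim a sel) (remaining D) by rewrite /m find_map.
  have lt : (m < size (remaining D))%N by rewrite fm -has_find.
  case: (remaining D) lt hs fm => [//|x0 r0]; set r := x0 :: r0 => lt hs fm.
  exists (nth x0 r m), (take m r), (drop m.+1 r); split.
  - by rewrite -drop_nth // cat_take_drop.
  - by rewrite has_take // -fm ltnn.
  - by rewrite fm; exact: (nth_find x0 hs).
  - by rewrite size_takel // ltnW.
have := remaining_sorted D; rewrite rE pairwise_cat allrel_consr /=.
move=> /and3P[/andP[uj0 _] _ /andP[j0v _]].
have memr j : (j \notin D) = (j \in remaining D) by rewrite mem_filter mem_enum andbT.
have j0D : j0 \notin D by rewrite memr rE mem_cat inE eqxx orbT.
have minj0 i : i \notin D -> sel (a i) -> (j0 <= i)%N.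
  rewrite memr rE mem_cat inE => /or3P[iu si|/eqP -> //|iv _].
    by case/hasP: uN; exists i.
  exact/ltnW/(allP j0v).
exists (j0 |: D).
  rewrite /mq_step -full_word fw.
  case: pickP => [j /and3P[jD js /forallP jmin]|/(_ j0)]; last first.
    move=> /negP[]; apply/and3P; split=> //.
    by apply/forallP => i; apply/implyP => /andP[]; exact: minj0.
  have -> : j = j0.
    apply/val_inj/eqP; rewrite eqn_leq minj0 // andbT.
    by have /implyP := jmin j0; apply; rewrite j0D.
  congr (Some (_, _)); rewrite mE cardE /enum_mem.
  rewrite (eq_filter (a2 := predI (fun i : 'I_N => (i < j0)%N) (fun j => j \notin D))).
    rewrite filter_predI -enumT -/(remaining D) rE filter_cat /= ltnn.
    rewrite (all_filterP _) // (eq_in_filter (a2 := pred0)) ?filter_pred0 ?cats0 //.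
    by move=> i /(allP j0v) /ltnW; rewrite /= leqNgt => /negbTE.
  by move=> i /=; rewrite !inE andbC.
rewrite /word -/(word D).
have -> : remaining (j0 |: D) = u ++ v.
  rewrite /remaining (eq_filter (a2 := predI (predC1 j0) (fun j => j \notin D))).
    rewrite filter_predI -/(remaining D) rE filter_cat /= eqxx /=.
    congr (_ ++ _); apply/all_filterP/allP => i.
      by move=> /(allP uj0) /= h; apply: contraTneq h => ->; rewrite ltnn.
    by move=> /(allP j0v) /= h; apply: contraTneq h => ->; rewrite ltnn.
  by move=> i /=; rewrite !inE negb_or.
rewrite /del /word rE !map_cat /= mE.
rewrite take_size_cat ?size_map // -cat_rcons drop_size_cat //.
by rewrite size_rcons size_map.
Qed.

End Step.

(** * The truncated process as a mean over words *)

Section Bridge.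
Variables (R : realType) (c : R) (n : nat).
Hypothesis n_gt0 : (0 < n)%N.
Notation k := (mq_k c).
Notation eps := (mq_eps c).

(** Pr[index > i]: [k] picks, and with probability [eps] one more, all avoid [i] given queues. *)
Definition mq_tau (i : nat) : R :=
  (1 - i%:R / n%:R) ^+ k * (1 - eps * (i%:R / n%:R)).

Notation s0 := (@finset.set0 'I_n).

Lemma avoid_prob (u : seq 'I_n) :
  \sum_(ch : choiceT n k) choice_weight ch * (~~ has (selected ch) u)%:R =
  mq_tau (lev s0 u).
Proof.
set B := s0 :|: [set x in u]; set x : R := 1 - #|B|%:R / n%:R.
have n0 : n%:R != 0 :> R by rewrite pnatr_eq0 -lt0n.
have avoidE (ch : choiceT n k) : (~~ has (selected ch) u)%:R =
    \prod_(i < k.+1) (~~ (((i < k)%N || ch.1) && (ch.2 i \in B)))%:R :> R.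
  have [/existsP[i]|/existsPn h] :=
      boolP [exists i : 'I_k.+1, ((i < k)%N || ch.1) && (ch.2 i \in B)].
    move=> /andP[hi iB]; rewrite (bigD1 i) //= hi iB mul0r.
    have /hasP -> // : exists2 y, y \in u & selected ch y.
    exists (ch.2 i); first by move: iB; rewrite !inE.
    by apply/existsP; exists i; rewrite hi eqxx.
  rewrite big1 => [|i _]; last by rewrite (negbTE (h i)).
  suff -> : has (selected ch) u = false by [].
  apply/negbTE/hasPn => y yu; apply/existsPn => i.
  have := h i; apply: contra => /andP[-> /eqP ->]; by rewrite !inE.
have cardB : \sum_(q < n) (q \notin B)%:R = n%:R * x :> R.
  have := avg_mem n_gt0 B (0 : R) 1; rewrite mulr0 add0r mulr1 -/x => <-.
  by rewrite mulVKf //; apply: eq_bigr => q _; case: (q \in B).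
(* The sum over all picks factors; the last pick is constrained only when [b] holds. *)
have sumf (b : bool) : \sum_(f : {ffun 'I_k.+1 -> 'I_n})
    (~~ has (selected (b, f)) u)%:R = (n%:R * x) ^+ k * (if b then n%:R * x else n%:R).
  under eq_bigr do rewrite avoidE /=.
  rewrite -(bigA_distr_bigA (fun (i : 'I_k.+1) (q : 'I_n) =>
    (~~ (((i < k)%N || b) && (q \in B)))%:R : R)) /=.
  rewrite big_ord_recr /= ltnn /=; congr (_ * _).
    rewrite (eq_bigr (fun=> n%:R * x)) => [|i _]; first by rewrite prodr_const card_ord.
    by rewrite -cardB; apply: eq_bigr => q _; rewrite /= ltn_ord.
  case: b => //=; by rewrite sumr_const card_ord.
rewrite -(pair_bigA _ (fun b f => @choice_weight R c n (b, f) *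
  (~~ has (selected (b, f)) u)%:R)) /= big_bool /=.
rewrite /choice_weight /= -!mulr_sumr !sumf /mq_tau -/B -/x.
rewrite exprMn exprS.
have e1 : eps * (#|B|%:R / n%:R) = eps * (1 - x) by rewrite /x; ring.
rewrite [lev _ _]/lev -/B e1.
move: (n%:R ^+ k) (expf_neq0 k n0) => nk nk0.
by field; rewrite nk0 n0.
Qed.

Lemma hit_prob (w : seq 'I_n) j : (j < size w)%N ->
  \sum_(ch : choiceT n k) choice_weight ch * (find (selected ch) w == j)%:R = hit mq_tau j w.
Proof.
move=> jw; rewrite /hit -!avoid_prob -sumrB; apply: eq_bigr => ch _.
rewrite -mulrBr; congr (_ * _); rewrite !has_take_leq ?(ltnW jw) // ltnS.
by case: ltngtP => //=; rewrite ?subrr ?subr0.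
Qed.

(** Probability that from [w] there are [s] deletions and then one of rank error [e], each from a
    full word; the value 0 mirrors the failure of [mq_step]. *)
Fixpoint hit_after s e (w : seq 'I_n) : R :=
  if full w then
    if s is s'.+1 then \sum_(j < size w) hit mq_tau j w * hit_after s' e (del j w)
    else hit mq_tau e w
  else 0.

Lemma hit_after_notfull s e w : ~~ full w -> hit_after s e w = 0.
Proof. by case: s => [|s] /= /negbTE ->. Qed.

Lemma sum_find_selected (w : seq 'I_n) (g : nat -> R) : (0 < k)%N -> full w ->
  \sum_(ch : choiceT n k) choice_weight ch * g (find (selected ch) w) =
  \sum_(j < size w) hit mq_tau j w * g j.
Proof.
move=> k0 fw.
have fs ch := find_selected_lt ch k0 fw.
under [RHS]eq_bigr => j _ do rewrite -(hit_prob (ltn_ord j)) mulr_suml.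
rewrite exchange_big /=; apply: eq_bigr => ch _.
rewrite (bigD1 (Ordinal (fs ch))) //= eqxx mulr1 big1 ?addr0 // => j jn.
case: eqP => h; last by rewrite mulr0 mul0r.
by move: jn; rewrite -val_eqE /= h eqxx.
Qed.

Lemma sum_mq_run N (a : {ffun 'I_N -> 'I_n}) s e D : (0 < k)%N ->
  sumseq s.+1 (fun chs : seq (choiceT n k) =>
    \prod_(ch <- chs) choice_weight ch * (mq_run a D chs == Some e)%:R) =
  hit_after s e (word a D).
Proof.
move=> k0; elim: s D => [|s IH] D.
  rewrite /=; under eq_bigr do rewrite big_seq1.
  have [fw|nfw] := boolP (full (word a D)); last first.
    rewrite big1 // => ch _.
    by rewrite /mq_step -full_word (negbTE nfw) /= mulr0.
  have [es|es] := ltnP e (size (word a D)).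
    rewrite -(hit_prob es); apply: eq_bigr => ch _.
    by have [D' -> _] := mq_step_word ch k0 fw.
  rewrite hit_oversize // big1 // => ch _.
  have [D' -> _] := mq_step_word ch k0 fw; rewrite /= /eq_op /=.
  case: eqP => h; last by rewrite mulr0.
  by have := find_selected_lt ch k0 fw; rewrite h ltnNge es.
rewrite -[LHS]/(\sum_(ch : choiceT n k) sumseq s.+1 (fun chs =>
  \prod_(x <- ch :: chs) choice_weight x * (mq_run a D (ch :: chs) == Some e)%:R)).
have [fw|nfw] := boolP (full (word a D)); last first.
  rewrite hit_after_notfull // big1 // => ch _.
  apply: sumseq_eq0 => -[|y t] // _.
  by rewrite /= /mq_step -full_word (negbTE nfw) /= mulr0.
rewrite [RHS]/= fw -(sum_find_selected (fun j => hit_after s e (del j (word a D)))) //.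
apply: eq_bigr => ch _; have [D' stepE wE] := mq_step_word ch k0 fw.
rewrite -wE -IH -sumseqZ; apply: eq_sumseq => -[|y t] // _.
by rewrite big_cons -mulrA [mq_run _ _ (ch :: _)]/= stepE.
Qed.

Lemma mq_probN_mean s e N : (0 < k)%N ->
  mq_probN c n s.+1 e N = mean N (hit_after s e).
Proof.
move=> k0; rewrite mean_sumseq -sum_ffun_sumseq mulr_sumr; apply: eq_bigr => a _.
under eq_bigr do rewrite -mulrA.
rewrite -mulr_sumr; congr (_ * _).
have wE : [seq a i | i : 'I_N] = word a finset.set0.
  rewrite /word /remaining (eq_filter (a2 := predT)) ?filter_predT // => j.
  by rewrite inE.
rewrite wE -sum_mq_run // -sum_ffun_sumseq; apply: eq_bigr => f _.
by congr (_ * _); rewrite big_map big_enum.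
Qed.

(** Duality moves the [s] deletions from the observable onto the density; each takes one letter,
    hence the length [L + s]. *)
Lemma mean_hit_after L s e F : (forall w, ~~ full w -> F w = 0) ->
  mean (L + s) (fun w => F w * hit_after s e w) =
  mean L (fun w => iter s (push mq_tau) F w * hit mq_tau e w).
Proof.
elim: s F => [|s IH] F F0.
  rewrite addn0; apply: eq_mean => w _ /=; case: (boolP (full w)) => // nfw.
  by rewrite F0 // !mul0r.
rewrite addnS iterSr -IH; last by move=> w /negbTE nf; rewrite /push nf.
transitivity (mean (L + s) (fun w => preimage_sum mq_tau F w * hit_after s e w)).
  rewrite mean_preimage_sum //; apply: eq_mean => w sw.
  have [fw|nfw] := boolP (full w); last by rewrite F0 // !mul0r.
  by rewrite /= fw sw.
apply: eq_mean => w _; rewrite /push; case: ifPn => // nfw.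
by rewrite hit_after_notfull // !mulr0.
Qed.

End Bridge.

(** * Riemann sums and the function f_c *)

Section Riemann.
Variables (R : realType) (g : R -> R) (n : nat).
Hypothesis n_gt0 : (0 < n)%N.
Hypothesis g_nd : {homo g : x y / x <= y}.
Hypothesis g_ge0 : forall x, 0 <= g x.
Notation mu := (@lebesgue_measure R).

Let mg (D : set R) : measurable D -> measurable_fun D (fun x : R => (g x)%:E).
Proof. by move=> mD; apply/measurable_EFinP; exact: nondecreasing_measurable. Qed.

Let integral_step (a b : R) : a <= b ->
  (((b - a) * g a)%:E <= \int[mu]_(x in `[a, b[) (g x)%:E <= ((b - a) * g b)%:E)%E.
Proof.
move=> ab.
have cstE (r : R) : (\int[mu]_(x in `[a, b[) (cst r%:E) x = ((b - a) * r)%:E)%E.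
  rewrite integral_cst //= lebesgue_measure_itv /= lte_fin.
  case: ltP => [_|ba]; first by rewrite -EFinB -EFinM mulrC.
  by rewrite mule0 (_ : b = a) ?subrr ?mul0r //; apply/eqP; rewrite eq_le ab ba.
rewrite -!cstE; apply/andP; split; apply: ge0_le_integral => //=.
- by move=> x _; rewrite lee_fin.
- exact: mg.
- by move=> x; rewrite /= in_itv /= => /andP[ax _]; rewrite lee_fin g_nd.
- by move=> x _; rewrite lee_fin.
- exact: mg.
- by move=> x; rewrite /= in_itv /= => /andP[_ /ltW xb]; rewrite lee_fin g_nd.
Qed.

Lemma integral_nondecreasing_bounds m :
  ((n%:R^-1 * \sum_(0 <= l < m) g (l%:R / n%:R))%:E
   <= \int[mu]_(x in `[0%R, (m%:R / n%:R)%R[) (g x)%:E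
   <= (n%:R^-1 * \sum_(0 <= l < m) g (l.+1%:R / n%:R))%:E)%E.
Proof.
have n0 : 0 < n%:R :> R by rewrite ltr0n.
elim: m => [|m IH].
  by rewrite mul0r set_itvco0 integral_set0 !big_geq // mulr0 lexx.
have le1 : m%:R / n%:R <= m.+1%:R / n%:R :> R.
  by rewrite ler_pM2r ?invr_gt0 // ler_nat.
rewrite (@itv_bndbnd_setU _ _ _ (BLeft (m%:R / n%:R))); last 2 first.
- by rewrite bnd_simp divr_ge0.
- by rewrite bnd_simp.
rewrite ge0_integral_setU //=; last 3 first.
- by apply: mg; exact: measurableU.
- by move=> x _; rewrite lee_fin.
- apply/disj_setPS => x [] /=; rewrite !in_itv /=.
  by move=> /andP[_ xm] /andP[mx _]; move: (lt_le_trans xm mx); rewrite ltxx.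
have := integral_step le1.
have -> : m.+1%:R / n%:R - m%:R / n%:R = n%:R^-1 :> R.
  by rewrite -mulrBl -natrB // subSnn mul1r.
rewrite !big_nat_recr //= !mulrDr !EFinD.
by case/andP: IH => h1 h2 /andP[h3 h4]; apply/andP; split; apply: leeD.
Qed.

(** The lower sum without its term at 0 and the upper sum differ by the value at 1. *)
Lemma integral01_bounds :
  ((\sum_(1 <= l < n) g (l%:R / n%:R))%:E
   <= n%:R%:E * \int[mu]_(x in `]0%R, 1%R[) (g x)%:E
   <= (\sum_(1 <= l < n) g (l%:R / n%:R) + g 1)%:E)%E.
Proof.
have n0 : 0 < n%:R :> R by rewrite ltr0n.
rewrite integral_itv_obnd_cbnd; last exact: mg.
have := integral_nondecreasing_bounds n; rewrite divff ?gt_eqF //.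
have pn : (0 <= n%:R%:E :> \bar R)%E by rewrite lee_fin ltW.
move=> /andP[/(lee_wpmul2l pn) h1 /(lee_wpmul2l pn) h2]; apply/andP; split.
  apply: le_trans h1; rewrite -EFinM lee_fin mulVKf ?gt_eqF //.
  by rewrite [X in _ <= X]big_ltn // lerDr.
apply: le_trans h2 _; rewrite -EFinM lee_fin mulVKf ?gt_eqF //.
have -> : \sum_(0 <= l < n) g (l.+1%:R / n%:R) = \sum_(1 <= l < n.+1) g (l%:R / n%:R).
  by rewrite big_add1.
by rewrite big_nat_recr //= divff ?gt_eqF.
Qed.

End Riemann.

Lemma eseries_EFin (R : realType) (u : nat -> R) (l : R) :
  \sum_(0 <= e < K) u e @[K --> \oo] --> l ->
  (\sum_(0 <= e <oo) (u e)%:E = l%:E)%E.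
Proof.
move=> cl; rewrite -(cvg_lim (@Rhausdorff R) cl) -EFin_lim; last by apply/cvg_ex; exists l.
by congr (limn _); apply/funext => K /=; rewrite sumEFin.
Qed.

(** * Power sums *)

Section PowerSums.
Variable R : realType.

(** The difference is a sum of [m.+1] products [(l + 1) ^+ (m - i) * l ^+ i], each between [l ^+ m]
    and [(l + 1) ^+ m]. *)
Lemma powS_sub_bounds (l : R) m : 0 <= l ->
  m.+1%:R * l ^+ m <= (l + 1) ^+ m.+1 - l ^+ m.+1 <= m.+1%:R * (l + 1) ^+ m.
Proof.
move=> l0; rewrite subrXX addrAC subrr add0r mul1r /=.
have l1 : l <= l + 1 by rewrite lerDl.
have l10 : 0 <= l + 1 by rewrite addr_ge0.
have cstE (x : R) : m.+1%:R * x = \sum_(i < m.+1) x.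
  by rewrite sumr_const card_ord mulr_natl.
have splitX (x : R) (i : 'I_m.+1) : x ^+ m = x ^+ (m - i) * x ^+ i.
  by rewrite -exprD subnK // -ltnS.
rewrite !cstE; apply/andP; split; apply: ler_sum => i _; rewrite (splitX _ i).
  by rewrite ler_wpM2r ?exprn_ge0 // lerXn2r.
by rewrite ler_wpM2l ?exprn_ge0 // lerXn2r.
Qed.

Lemma sum_pow_le m N :
  m.+1%:R * \sum_(0 <= l < N) (l%:R : R) ^+ m <= N%:R ^+ m.+1.
Proof.
elim: N => [|N IH]; first by rewrite big_geq // mulr0 exprn_ge0.
rewrite big_nat_recr //= mulrDr.
have /andP[h _] := @powS_sub_bounds N%:R m (ler0n _ _).
by have := lerD IH h; rewrite natr1 addrC addrCA subrr addr0 addrC.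
Qed.

Lemma sum_pow_ge m N :
  N%:R ^+ m.+1 <= m.+1%:R * \sum_(1 <= l < N.+1) (l%:R : R) ^+ m.
Proof.
elim: N => [|N IH]; first by rewrite big_geq // mulr0 expr0n.
rewrite big_nat_recr //= mulrDr.
have /andP[_ h] := @powS_sub_bounds N%:R m (ler0n _ _).
by have := lerD IH h; rewrite natr1 addrCA subrr addr0.
Qed.

Lemma sum_frac_pow_bounds m n : (0 < n)%N ->
  n%:R / m.+1%:R - 1 <= \sum_(1 <= l < n) (l%:R / n%:R : R) ^+ m <= n%:R / m.+1%:R.
Proof.
move=> n_gt0; have n0 : 0 < n%:R :> R by rewrite ltr0n.
have nm0 : 0 < n%:R ^+ m :> R by rewrite exprn_gt0.
under eq_bigr do rewrite expr_div_n.
rewrite -mulr_suml; set S := \sum_(_ <= _ < _) _.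
have m0 : 0 < m.+1%:R :> R by rewrite ltr0n.
apply/andP; split.
  have := sum_pow_ge m n; rewrite big_nat_recr //= -/S exprS mulrDr => h.
  rewrite lerBlDr ler_pdivrMr // -(ler_pM2r nm0) -[X in _ <= X]mulrAC mulrDl divfK ?gt_eqF //.
  by lra.
have := sum_pow_le m n; rewrite big_ltn // mulrDr -/S exprS => h.
(* For [m = 0] the term at [l = 0] is 1, so just its sign is used. *)
have z0 : 0 <= m.+1%:R * (0%:R : R) ^+ m by rewrite mulr_ge0 // exprn_ge0.
rewrite ler_pdivlMr // mulrAC ler_pdivrMr // mulrC; lra.
Qed.

Lemma sum_first n : \sum_(1 <= l < n.+1) (l%:R : R) = n%:R * (n%:R + 1) / 2.
Proof.
elim: n => [|n IH]; first by rewrite big_geq // !mul0r.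
by rewrite big_nat_recr //= IH -natr1; field.
Qed.

Lemma sum_squares n :
  \sum_(1 <= l < n.+1) (l%:R : R) ^+ 2 = n%:R * (n%:R + 1) * (2 * n%:R + 1) / 6.
Proof.
elim: n => [|n IH]; first by rewrite big_geq // !mul0r.
by rewrite big_nat_recr //= IH -natr1; field.
Qed.

(** For [c = 2] and for [1 < c < 2] the summand [f_c] is a quadratic polynomial in l / n, which
    makes the mean explicit. *)
Lemma sum_quadratic (a b d : R) n : (0 < n)%N ->
  \sum_(1 <= l < n) (a + b * (l%:R / n%:R) + d * (l%:R / n%:R) ^+ 2) =
  a * (n%:R - 1) + b * (n%:R - 1) / 2 + d * (n%:R - 1) * (2 * n%:R - 1) / (6 * n%:R).
Proof.
case: n => // n _; set N : R := n.+1%:R.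
have N0 : N != 0 by rewrite pnatr_eq0.
rewrite 2!big_split /= sumr_const_nat subn1 /= -!mulr_sumr.
under [X in _ + d * X]eq_bigr do rewrite expr_div_n.
rewrite -!mulr_suml sum_first sum_squares -[a *+ n]mulr_natr.
have -> : n%:R = N - 1 :> R by rewrite /N -natr1 addrK.
by field.
Qed.

End PowerSums.

(** * Monotonicity and bounds of the continuous extension of f_c *)

Section RankFunction.
Variables (R : realType) (m : nat) (e : R).
Hypothesis e01 : 0 <= e < 1.
Hypothesis me : 0 < m%:R + e.

Let e0 : 0 <= e.
Proof. by case/andP: e01. Qed.
Let e1 : e < 1.
Proof. by case/andP: e01. Qed.

(* [fbar] extends [f_c] continuously to [x = 1], where the quotient defining [f_c]
   is [0 / 0]. *)
Definition hc (x : R) := x ^+ m * (1 - e + e * x).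
Definition Qc (x : R) := \sum_(j < m) x ^+ j + e * x ^+ m.
Definition fbar (x : R) := hc x * (1 + hc x / Qc x).

(** Extracts the factor [1 - x] responsible for the 0 / 0 at 1; [Qc] stays positive there. *)
Lemma sub1_hc x : 1 - hc x = (1 - x) * Qc x.
Proof.
have := subrX1 x m; rewrite /hc /Qc; move: (\sum_(_ < _) _) => S h.
have {}h : x ^+ m = 1 + (x - 1) * S by rewrite -h addrC subrK.
by rewrite mulrDr h; ring.
Qed.

Lemma Qc_gt0 x : 0 <= x -> 0 < Qc x.
Proof.
rewrite /Qc; case: m me => [|m'] h x0.
  by rewrite big_ord0 add0r expr0 mulr1; move: h; rewrite add0r.
rewrite big_ord_recl expr0 ltr_wpDr ?mulr_ge0 ?exprn_ge0 //.
by rewrite ltr_wpDr // sumr_ge0 // => j _; rewrite exprn_ge0.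
Qed.

Lemma hc_ge0 x : 0 <= x -> 0 <= hc x.
Proof.
by move=> x0; rewrite mulr_ge0 ?exprn_ge0 // addr_ge0 ?mulr_ge0 // subr_ge0 ltW.
Qed.

Lemma hc_le x y : 0 <= x -> x <= y -> hc x <= hc y.
Proof.
move=> x0 xy; have y0 := le_trans x0 xy; apply: ler_pM.
- exact: exprn_ge0.
- by rewrite addr_ge0 ?mulr_ge0 // subr_ge0 ltW.
- exact: lerXn2r.
- by rewrite lerD2l ler_wpM2l.
Qed.

Lemma hc_div_Qc_le (x y : R) : 0 <= x -> x <= y -> hc x / Qc x <= hc y / Qc y.
Proof.
move=> x0 xy; have y0 := le_trans x0 xy.
rewrite /hc -[_ / Qc x]mulrAC -[_ / Qc y]mulrAC; apply: ler_pM.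
- by rewrite divr_ge0 ?exprn_ge0 // ltW // Qc_gt0.
- by rewrite addr_ge0 ?mulr_ge0 // subr_ge0 ltW.
(* After cross-multiplication, termwise x^m y^j <= y^m x^j for j <= m. *)
- rewrite ler_pdivrMr ?Qc_gt0 // mulrAC ler_pdivlMr ?Qc_gt0 //.
  rewrite /Qc !mulrDr !mulr_sumr; apply: lerD; last first.
    by rewrite mulrCA [X in _ <= X]mulrCA [y ^+ m * _]mulrC.
  apply: ler_sum => j _; have jm := ltnW (ltn_ord j).
  have splitX (z : R) : z ^+ m = z ^+ (m - j) * z ^+ j by rewrite -exprD subnK.
  rewrite !splitX -!mulrA [x ^+ j * y ^+ j]mulrC.
  by apply: ler_wpM2r; [rewrite mulr_ge0 ?exprn_ge0|exact: lerXn2r].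
- by rewrite lerD2l ler_wpM2l.
Qed.

Lemma fbar_ge0 x : 0 <= x -> 0 <= fbar x.
Proof.
move=> x0; rewrite mulr_ge0 ?hc_ge0 // addr_ge0 // divr_ge0 ?hc_ge0 //.
exact/ltW/Qc_gt0.
Qed.

Lemma fbar_le x y : 0 <= x -> x <= y -> fbar x <= fbar y.
Proof.
move=> x0 xy; apply: ler_pM; rewrite ?hc_ge0 ?hc_le ?lerD2l ?hc_div_Qc_le //.
by rewrite addr_ge0 // divr_ge0 ?hc_ge0 // ltW // Qc_gt0.
Qed.

(** For [m] = floor c - 1 and [e] = c - floor c this is c / (c - 1), the error of the Riemann
    sum. *)
Lemma fbar1 : fbar 1 = (m%:R + e + 1) / (m%:R + e).
Proof.
have -> : fbar 1 = 1 * (1 + 1 / (m%:R + e)).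
  rewrite /fbar (_ : hc 1 = 1); last by rewrite /hc expr1n mulr1 subrK mul1r.
  rewrite /Qc expr1n mulr1; under eq_bigr do rewrite expr1n.
  by rewrite sumr_const card_ord.
by field; rewrite gt_eqF.
Qed.

(** [1 - e + e * x] is at least [x], and is 1 when [e = 0]; in both cases the exponent stands for
    ceil c - 1. *)
Lemma fbar_lower (x : R) : 0 <= x <= 1 -> x ^+ (m + (0 < e)%R) <= fbar x.
Proof.
move=> /andP[x0 x1]; apply: le_trans (_ : hc x <= _); last first.
  by rewrite /fbar ler_peMr ?hc_ge0 // lerDl divr_ge0 ?hc_ge0 // ltW // Qc_gt0.
rewrite exprD ler_wpM2l ?exprn_ge0 //.
case: ltP => [_|h].
  have : 0 <= (1 - e) * (1 - x) by rewrite mulr_ge0 // subr_ge0 // ltW.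
  by rewrite expr1; lra.
by rewrite expr0 (_ : e = 0) ?subr0 ?mul0r ?addr0 //; apply/eqP; rewrite eq_le h e0.
Qed.

(** [hc x <= x ^+ m] and [Qc x >= m%:R * x ^+ m], so the second factor is at most 1 + 1 / m. *)
Lemma fbar_upper (x : R) : (0 < m)%N -> 0 <= x <= 1 ->
  fbar x <= m.+1%:R / m%:R * x ^+ m.
Proof.
move=> m_gt0 /andP[x0 x1]; have m0 : 0 < m%:R :> R by rewrite ltr0n.
have hx : hc x <= x ^+ m.
  rewrite /hc ler_piMr ?exprn_ge0 //.
  by have : 0 <= e * (1 - x); [rewrite mulr_ge0 // subr_ge0|lra].
rewrite mulrC; apply: ler_pM => //; first exact: hc_ge0.
  by rewrite addr_ge0 // divr_ge0 ?hc_ge0 // ltW // Qc_gt0.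
rewrite -natr1 mulrDl divff ?gt_eqF // mul1r lerD2l ler_pdivrMr ?Qc_gt0 //.
rewrite ler_pdivlMl //; apply: le_trans (_ : m%:R * x ^+ m <= _).
  by rewrite ler_wpM2l // ltW.
apply: le_trans (_ : \sum_(j < m) x ^+ j <= _); last first.
  by rewrite lerDl mulr_ge0 ?exprn_ge0.
rewrite -[m in m%:R]card_ord mulr_natl -sumr_const; apply: ler_sum => j _.
by apply: ler_wiXn2l => //; exact: ltnW.
Qed.

End RankFunction.

(** * The c-MultiQueue as an instance of the chain *)

Section MultiQueue.
Variables (R : realType) (c : R) (n : nat).
Hypothesis c_gt1 : 1 < c.
Hypothesis n_gt0 : (0 < n)%N.
Notation k := (mq_k c).
Notation m := (mq_k c).-1.
Notation eps := (mq_eps c).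
Notation tau := (mq_tau c n).

Lemma floor_mq_k : (Num.floor c)%:~R = k%:R :> R.
Proof.
have c0 : 0 <= c by rewrite ltW // (lt_trans ltr01).
by rewrite /mq_k truncn_floor c0 -[in LHS](gez0_abs (m := Num.floor c)) ?floor_ge0.
Qed.

Lemma mq_eps_itv : 0 <= eps < 1.
Proof.
have := floor_itv c; rewrite /mq_eps intrD mulr1z => /andP[h1 h2].
by rewrite subr_ge0 h1 ltrBlDr addrC.
Qed.

Lemma mq_cE : c = k%:R + eps.
Proof. by rewrite /mq_eps floor_mq_k addrC subrK. Qed.

Lemma mq_k_gt0 : (0 < k)%N.
Proof.
rewrite lt0n; apply/eqP => k0; have := mq_cE; rewrite k0 add0r => cE.
by have := mq_eps_itv; rewrite -cE => /andP[_]; rewrite ltNge (ltW c_gt1).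
Qed.

Lemma mq_kE : k%:R = m%:R + 1 :> R.
Proof. by rewrite natr1 prednK // mq_k_gt0. Qed.

Lemma mq_c_sub1 : c - 1 = m%:R + eps.
Proof. by rewrite [in LHS]mq_cE mq_kE; ring. Qed.

Lemma mq_m_eps_gt0 : 0 < m%:R + eps.
Proof. by rewrite -mq_c_sub1 subr_gt0. Qed.

Notation h := (hc m eps).
Notation f := (fbar m eps).

Lemma hc_lt1 x : 0 <= x < 1 -> h x < 1.
Proof.
move=> /andP[x0 x1]; rewrite -subr_gt0 sub1_hc mulr_gt0 ?subr_gt0 //.
exact: Qc_gt0 mq_eps_itv mq_m_eps_gt0 _ x0.
Qed.

Lemma f_cE x : f_c c x = h x * ((1 - x * h x) / (1 - h x)).
Proof.
rewrite /f_c /hc -{2}(prednK mq_k_gt0) exprS; congr (_ * (_ / _)).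
by rewrite mulrA.
Qed.

Lemma f_c_fbar x : 0 <= x < 1 -> f_c c x = f x.
Proof.
move=> x01; have /andP[x0 x1] := x01; rewrite f_cE /fbar.
have Q0 : Qc m eps x != 0 by rewrite gt_eqF // (Qc_gt0 mq_eps_itv mq_m_eps_gt0 x0).
have x10 : 1 - x != 0 by rewrite gt_eqF // subr_gt0.
(* Since [1 - h x = (1 - x) * Qc m eps x], the quotient in [f_c] becomes 1 + h / Qc. *)
have -> : 1 - x * h x = (1 - h x) + (1 - x) * h x by ring.
rewrite sub1_hc; move: (h x) (Qc m eps x) Q0 => a Q Q0.
by field; rewrite Q0 x10.
Qed.

Notation co i := (1 - i%:R / n%:R : R).

Lemma co_itv i : (i <= n)%N -> 0 <= co i <= 1.
Proof.
move=> ilen; rewrite subr_ge0 lerBlDr lerDl divr_ge0 // andbT.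
by rewrite ler_pdivrMr ?ltr0n // mul1r ler_nat.
Qed.

Lemma mq_tauE i : tau i = co i * h (co i).
Proof.
rewrite /mq_tau /hc mulrA -exprS prednK ?mq_k_gt0 //; congr (_ * _).
ring.
Qed.

Lemma mq_tau0 : tau 0 = 1.
Proof. by rewrite /mq_tau mul0r mulr0 !subr0 expr1n mulr1. Qed.

Lemma mq_taun : tau n = 0.
Proof.
rewrite /mq_tau divff ?pnatr_eq0 -?lt0n // subrr expr0n.
by rewrite gtn_eqF ?mq_k_gt0 // mul0r.
Qed.

Lemma mq_tau_anti i j : (i <= j <= n)%N -> tau j <= tau i.
Proof.
move=> /andP[ij jn]; rewrite !mq_tauE.
have /andP[cj0 _] := co_itv jn.
have cij : co j <= co i.
  by rewrite lerD2l lerN2 ler_wpM2r ?invr_ge0 // ler_nat.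
apply: ler_pM => //; first exact: hc_ge0 mq_eps_itv _ cj0.
exact: hc_le mq_eps_itv _ _ cj0 cij.
Qed.

Lemma co_itvoo i : (0 < i < n)%N -> 0 < co i < 1.
Proof.
move=> /andP[i0 ltin]; rewrite subr_gt0 gtrBl divr_gt0 ?ltr0n // andbT.
by rewrite ltr_pdivrMr ?ltr0n // mul1r ltr_nat.
Qed.

(** Here [c > 1] gives [h x < 1] for [x < 1], the source of stability. *)
Lemma mq_tau_lt i : (0 < i < n)%N -> tau i < co i.
Proof.
move=> /co_itvoo /andP[c0 c1]; rewrite mq_tauE gtr_pMr //.
by rewrite hc_lt1 // ltW.
Qed.

Lemma rank_error_law_lim_mean s e :
  rank_error_law c n s.+1 e = lim_mean (fun w : seq 'I_n => phi tau s w * hit tau e w).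
Proof.
(* The truncation length is [L + s], as the earlier deletions use up [s] letters. *)
apply: cvg_lim => //; rewrite -(cvg_shiftn s).
have -> : (fun L => mq_probN c n s.+1 e (L + s)) =
    (fun L => mean L (fun w : seq 'I_n => phi tau s w * hit tau e w)).
  apply/funext => L; rewrite mq_probN_mean ?mq_k_gt0 //.
  rewrite -mean_hit_after // => [|w /negbTE -> //].
  apply: eq_mean => w _; case: (boolP (full w)) => fw; first by rewrite mul1r.
  by rewrite hit_after_notfull // mulr0.
have dphi := phi_dominated n_gt0 mq_tau0 mq_taun mq_tau_anti mq_tau_lt s.
have dhit := dominated_hit mq_tau0 mq_taun mq_tau_anti e dphi.
exact: (mean_cvg n_gt0 mq_taun mq_tau_lt dhit).
Qed.

(** The reflection l -> n - l turns [1 - i / n], the argument at which [tau] is expressed by [h],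
    into a sample point of [f_c]. *)
Lemma mean_rankE :
  \sum_(1 <= l < n) tau l / (1 - l%:R / n%:R * isig tau l) =
  \sum_(1 <= l < n) f (l%:R / n%:R).
Proof.
rewrite big_nat_rev /= !big_nat; apply: eq_bigr => l /andP[l0 ln].
rewrite add1n subSS; set i := (n - l)%N.
have i0n : (0 < i < n)%N by rewrite /i; lia.
have lE : l%:R / n%:R = co i.
  have n0 : n%:R != 0 :> R by rewrite pnatr_eq0 -lt0n.
  by rewrite /i natrB ?(ltnW ln) //; field.
have := co_itvoo i0n; rewrite lE /isig mq_tauE; set x := co i => x01.
have /andP[x0 x1] := x01.
have -> : i%:R / n%:R = 1 - x by rewrite /x; ring.
rewrite -f_c_fbar ?(ltW x0) // f_cE.
have h1 : h x < 1 by rewrite hc_lt1 // ltW.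
have xh1 : x * h x < 1.
  have := hc_ge0 m mq_eps_itv (ltW x0); nra.
move: (h x) h1 xh1 => a a1 xa1.
have n1 : 1 - x * a != 0 by rewrite gt_eqF // subr_gt0.
have n2 : 1 - a != 0 by rewrite gt_eqF // subr_gt0.
have n3 : x != 0 by rewrite gt_eqF.
have -> : 1 - (1 - x) * (1 - x * a)^-1 = x * (1 - a) / (1 - x * a) by field.
by field; rewrite n1 n2 n3.
Qed.

Lemma ceil_mq : (Num.ceil c)%:~R = (m + (0 < eps)%R).+1%:R :> R.
Proof.
rewrite ceil_floor intrD floor_mq_k -addSn prednK ?mq_k_gt0 // natrD; congr (_ + _).
have -> : (c \isn't a Num.int) = (0 < eps).
  by rewrite intrEfloor /mq_eps subr_gt0 lt_neqAle; case/andP: (floor_itv c) => ->; rewrite andbT.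
by case: (0 < eps).
Qed.

Lemma integral_f_c_bounds :
  ((\sum_(1 <= l < n) f (l%:R / n%:R))%:E
   <= n%:R%:E * \int[lebesgue_measure]_(x in `]0%R, 1%R[) (f_c c x)%:E
   <= (\sum_(1 <= l < n) f (l%:R / n%:R) + c / (c - 1))%:E)%E.
Proof.
(* Clamping at 0 makes [g] monotone and nonnegative on the whole line, with unchanged values for
   [x >= 0]. *)
pose g x := f (Num.max 0 x).
have g_nd : {homo g : x y / x <= y}.
  move=> x y xy; apply: (fbar_le mq_eps_itv mq_m_eps_gt0); first by rewrite le_max lexx.
  by rewrite ge_max !le_max lexx xy orbT.
have g_ge0 x : 0 <= g x.
  by apply: (fbar_ge0 mq_eps_itv mq_m_eps_gt0); rewrite le_max lexx.
have := integral01_bounds n_gt0 g_nd g_ge0.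
have gE x : 0 <= x -> g x = f x by move=> x0; rewrite /g max_r.
rewrite (eq_bigr (fun l : nat => f (l%:R / n%:R))); last by move=> l _; rewrite gE // divr_ge0.
rewrite gE // fbar1 ?mq_m_eps_gt0 // -mq_c_sub1 subrK.
suff -> : (\int[lebesgue_measure]_(x in `]0%R, 1%R[) (g x)%:E =
    \int[lebesgue_measure]_(x in `]0%R, 1%R[) (f_c c x)%:E)%E by [].
apply: eq_integral => x; rewrite inE /= in_itv /= => /andP[x0 x1].
by rewrite f_c_fbar ?gE ?(ltW x0).
Qed.

End MultiQueue.

Theorem theorem3 (R : realType) (c : R) (n : nat) :
  1 < c -> (0 < n)%N ->
  exists pE : nat -> R,
    (* E is a random variable on nat with law pE *)
    (forall e, 0 <= pE e) /\ (\sum_(0 <= e <oo) (pE e)%:E = 1)%E /\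
    (* E^(s) converges in distribution to E *)
    (forall e : nat, (fun s => rank_error_law c n s e) @ \oo --> pE e) /\
    let EE := (\sum_(0 <= e <oo) (e%:R * pE e)%:E)%E in
    let eps := mq_eps c in
    let I := (\int[lebesgue_measure]_(x in `]0%R, 1%R[) (f_c c x)%:E)%E in
    (c = 2 -> EE = (5 / 6 * n%:R - 1 + 1 / (6 * n%:R))%:E) /\
    (0 < eps -> c = 1 + eps ->
       EE = ((eps^-1 - eps / 6) * n%:R - eps^-1 + eps / (6 * n%:R))%:E) /\
    (n%:R%:E * I - (c / (c - 1))%:E <= EE <= n%:R%:E * I)%E /\
    (2 <= c ->
       ((n%:R / (Num.ceil c)%:~R - c / (c - 1))%:E <= EE)%E /\
       (EE <= (n%:R / ((Num.floor c)%:~R - 1))%:E)%E).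
Proof.
move=> c1 n0.
have t0 := mq_tau0 c n; have tn := mq_taun c1 n0.
have ta := mq_tau_anti c1 n0; have tl := mq_tau_lt c1 n0.
have n0' : n%:R != 0 :> R by rewrite pnatr_eq0 -lt0n.
have eitv := mq_eps_itv c; have megt := mq_m_eps_gt0 c1.
exists (pE n (mq_tau c n)).
split; first by move=> e; exact: pE_ge0 n0 t0 tn ta tl e.
split; first exact: eseries_EFin (sum_pE1 n0 t0 tn ta tl).
split=> [e|].
  rewrite -(cvg_shiftS (fun s => rank_error_law c n s e)) /=.
  under eq_cvg do rewrite rank_error_law_lim_mean //.
  exact: law_cvg_pE n0 t0 tn ta tl e.
rewrite (eseries_EFin (mean_rank_cvg n0 t0 tn ta tl)) mean_rankE //.
set S := \sum_(_ <= _ < _) _.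
move=> EE eps I; rewrite {}/EE; split; [|split; [|split]].
- move=> c2.
  have k2 : mq_k c = 2%N.
    have kE := mq_cE c1; rewrite [in LHS]c2 in kE; case/andP: eitv => ep0 ep1.
    by apply/eqP; rewrite eqn_leq -(ler_nat R) -(ltr_nat R 1); apply/andP; split; lra.
  have e0 : mq_eps c = 0 by have := mq_cE c1; rewrite k2 c2; lra.
  rewrite /S k2 e0 /=.
  rewrite (eq_bigr (fun l => 0 + 1 * (l%:R / n%:R) + 1 * (l%:R / n%:R) ^+ 2)).
    by rewrite sum_quadratic //; congr (_%:E); field.
  move=> l _; rewrite /fbar /hc /Qc big_ord1 !mul0r !addr0 subr0 expr0 expr1 divr1.
  ring.
- move=> e0 cE.
  have k1 : mq_k c = 1%N.
    have := mq_cE c1; rewrite {1}cE => /addIr /esym /eqP; rewrite -[1 in X in _ == X]/(1%:R).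
    by rewrite eqr_nat => /eqP.
  rewrite /S k1 /=; have en0 : eps != 0 by rewrite gt_eqF.
  (* With floor c = 1, [Qc] is the constant [eps] and [hc] is affine, so [fbar] is quadratic. *)
  rewrite (eq_bigr (fun l => (1 - eps) / eps + (2 - eps) * (l%:R / n%:R)
     + eps * (l%:R / n%:R) ^+ 2)).
    by rewrite sum_quadratic //; congr (_%:E); field; rewrite n0' en0.
  move=> l _; rewrite /fbar /hc /Qc big_ord0 expr0 add0r mulr1 !mul1r -/eps.
  by move: (l%:R / n%:R) => x; field.
- have /andP[h1 h2] := integral_f_c_bounds c1 n0.
  by rewrite h1 andbT leeBlDr //.
- move=> c2; rewrite !lee_fin; split.
    have Sge : \sum_(1 <= l < n) (l%:R / n%:R : R) ^+ ((mq_k c).-1 + (0 < eps)%R) <= S.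
      rewrite /S !big_nat; apply: ler_sum => l /andP[_ ln].
      apply: (fbar_lower eitv megt); rewrite divr_ge0 //=.
      by rewrite ler_pdivrMr ?ltr0n // mul1r ler_nat ltnW.
    apply: le_trans Sge; rewrite ceil_mq //.
    have /andP[h _] := sum_frac_pow_bounds R ((mq_k c).-1 + (0 < eps)%R) n0.
    (* The loss of 1 in the power sum is at most c / (c - 1). *)
    apply: le_trans h; rewrite lerD2l lerN2 ler_pdivlMr ?subr_gt0 //; lra.
  rewrite floor_mq_k // mq_kE // addrK.
  have m0 : (0 < (mq_k c).-1)%N.
    rewrite lt0n; apply/eqP => m0; have := mq_c_sub1 c1; rewrite m0 add0r.
    case/andP: eitv => _; lra.
  have mR : 0 < (mq_k c).-1%:R :> R by rewrite ltr0n.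
  apply: le_trans (_ : \sum_(1 <= l < n) ((mq_k c).-1.+1%:R / (mq_k c).-1%:R *
      (l%:R / n%:R : R) ^+ (mq_k c).-1) <= _).
    rewrite /S !big_nat; apply: ler_sum => l /andP[_ ln].
    apply: (fbar_upper eitv megt) => //; rewrite divr_ge0 //=.
    by rewrite ler_pdivrMr ?ltr0n // mul1r ler_nat ltnW.
  rewrite -mulr_sumr; have /andP[_ h] := sum_frac_pow_bounds R (mq_k c).-1 n0.
  have p0 : 0 <= (mq_k c).-1.+1%:R / (mq_k c).-1%:R :> R by rewrite divr_ge0.
  apply: le_trans (ler_wpM2l p0 h) _.
  rewrite le_eqVlt; apply/orP; left; apply/eqP; field.
  by rewrite gt_eqF //= natr1 pnatr_eq0.
Qed.
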